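(* Let $n\ge 0$ and, for $1\le i\le n$, let $s_i,t_i$ be expressions of $L_{need,\oplus}$ such that for every $k\ge 0$ and every reduction context $R$ there exists $d\ge 0$ with $\mathit{ExCv}(R[s_i],k)\le \mathit{ExCv}(R[t_i],k+d)$. Let $C$ be a multicontext with $n$ holes. Then $\mathit{ExCv}(C[s_1,\dots,s_n])\le \mathit{ExCv}(C[t_1,\dots,t_n])$.
   Context: Expressions of the calculus $L_{need,\oplus}$ are given by $s,t,r ::= x \mid \lambda x.s \mid (s\,t) \mid (s\oplus t) \mid \mathtt{let}\ env\ \mathtt{in}\ s$ over a countably infinite set of variables, where an environment $env$ is a (possibly empty) multiset of bindings $x_1=s_1,\dots,x_n=s_n$ with pairwise distinct $x_i$; in $\mathtt{let}\ x_1=s_1,\dots,x_n=s_n\ \mathtt{in}\ t$ the scope of the $x_i$ is $s_1,\dots,s_n,t$ (recursive let). Expressions are taken up to $\alpha$-equivalence (distinct variable convention). $\{x_i=s_{f(i)}\}_{i=j}^m$ abbreviates the bindings $x_j=s_{f(j)},\dots,x_m=s_{f(m)}$ (empty if $m<j$). A context is an expression with exactly one hole $[\cdot]$ at an arbitrary expression position. A multicontext $C[\cdot_1,\dots,\cdot_n]$ is an expression with $n$ holes, each occurring exactly once; $C[s_1,\dots,s_n]$ denotes the result of placing $s_i$ in hole $i$. Application contexts: $A ::= [\cdot] \mid (A\ s)$. Reduction contexts: $R ::= A \mid \mathtt{let}\ env\ \mathtt{in}\ A \mid \mathtt{let}\ env, \{x_i=A_i[x_{i+1}]\}_{i=1}^n,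 x_{n+1}=A_{n+1}\ \mathtt{in}\ A[x_1]$ ($n\ge0$). Standard reduction $\xrightarrow{sr}$ is the union of the rules (applied to the whole expression): (lbeta) $R[((\lambda x.s)\ t)] \to R[\mathtt{let}\ x=t\ \mathtt{in}\ s]$; (probl) $R[s\oplus t]\to R[s]$; (probr) $R[s\oplus t]\to R[t]$; (lapp) $R[((\mathtt{let}\ env\ \mathtt{in}\ s)\ t)] \to R[\mathtt{let}\ env\ \mathtt{in}\ (s\ t)]$; (llet-in) $\mathtt{let}\ env_1\ \mathtt{in}\ (\mathtt{let}\ env_2\ \mathtt{in}\ s) \to \mathtt{let}\ env_1,env_2\ \mathtt{in}\ s$; (llet-e) $\mathtt{let}\ \{x_i=A_i[x_{i+1}]\}_{i=1}^{n-1}, x_n=(\mathtt{let}\ env_1\ \mathtt{in}\ s), env_2\ \mathtt{in}\ A[x_1] \to \mathtt{let}\ \{x_i=A_i[x_{i+1}]\}_{i=1}^{n-1}, x_n=s, env_1, env_2\ \mathtt{in}\ A[x_1]$; (cp-in) $\mathtt{let}\ \{x_i=x_{i+1}\}_{i=1}^{n-1}, x_n=\lambda y.s, env\ \mathtt{in}\ A[x_1] \to \mathtt{let}\ \{x_i=x_{i+1}\}_{i=1}^{n-1}, x_n=\lambda y.s, env\ \mathtt{in}\ A[\lambda y.s]$; (cp-e) $\mathtt{let}\ \{x_i=A_i[x_{i+1}]\}_{i=1}^{n-1}, x_n=A_n[y_1], \{y_j=y_{j+1}\}_{j=1}^{m-1}, y_m=\lambda z.s, env\ \mathtt{in}\ A[x_1]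 \to \mathtt{let}\ \{x_i=A_i[x_{i+1}]\}_{i=1}^{n-1}, x_n=A_n[\lambda z.s], \{y_j=y_{j+1}\}_{j=1}^{m-1}, y_m=\lambda z.s, env\ \mathtt{in}\ A[x_1]$ where $A_n\ne[\cdot]$, $n,m\ge1$. Steps by (probl) or (probr) are prob-reductions. A WHNF is an abstraction or an expression $\mathtt{let}\ env\ \mathtt{in}\ \lambda x.s$. An evaluation of $s$ is a finite sequence of standard reduction steps from $s$ to a WHNF; its prob-length is the number of prob-reductions in it. The expected convergence is $\mathit{ExCv}(s)=\sum 2^{-m}$, summing over all evaluations of $s$ with $m$ the prob-length of the evaluation; $\mathit{ExCv}(s,k)$ is the same sum restricted to evaluations of prob-length at most $k$. *)

(* Defs.v *)
From HB Require Import structures.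
From mathcomp Require Import all_boot all_order all_algebra generic_quotient.
From mathcomp Require Import boolp classical_sets reals ereal esum.

Set Implicit Arguments.
Unset Strict Implicit.
Unset Printing Implicit Defensive.

Local Open Scope quotient_scope.

Notation var := nat (only parsing).

(* Named syntax with holes labelled in H. Expressions have no hole;
   multicontexts are terms with holes in 'I_n. Binders are concrete names, so
   that plugging may capture. *)
Inductive term (H : Type) : Type :=
| Hole of H
| Var of var
| Lam of var & term H
| App of term H & term H
| Prob of term H & term H
| Let of seq (var * term H) & term H.

Arguments Hole {H} _.
Arguments Var {H} _.

HB.instance Definition _ (H : Type) := gen_eqMixin (term H).
HB.instance Definition _ (H : Type) := gen_choiceMixin (term H).

Notation expr := (term void).
Notation env H := (seq (var * term H)).

Definition dom {T : Type} (e : seq (var * T)) : seq var := map fst e.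

Section Terms.
Variable H : Type.

Fixpoint wf (s : term H) : bool :=
  match s with
  | Hole _ | Var _ => true
  | Lam _ s => wf s
  | App s t | Prob s t => wf s && wf t
  | Let e s => [&& uniq (dom e), all (fun b => wf b.2) e & wf s]
  end.

Fixpoint fv (s : term H) : seq var :=
  match s with
  | Hole _ => [::]
  | Var x => [:: x]
  | Lam x s => [seq y <- fv s | y != x]
  | App s t | Prob s t => fv s ++ fv t
  | Let e s => [seq y <- flatten [seq fv b.2 | b <- e] ++ fv s | y \notin dom e]
  end.

(* All binding occurrences, with repetitions. *)
Fixpoint bv (s : term H) : seq var :=
  match s with
  | Hole _ | Var _ => [::]
  | Lam x s => x :: bv s
  | App s t | Prob s t => bv s ++ bv t
  | Let e s => dom e ++ flatten [seq bv b.2 | b <- e] ++ bv s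
  end.

Definition swapv (x y z : var) : var :=
  if z == x then y else if z == y then x else z.

(* The transposition (x y) acts on all names, free, bound and binding. *)
Fixpoint swap (x y : var) (s : term H) : term H :=
  match s with
  | Hole h => Hole h
  | Var z => Var (swapv x y z)
  | Lam z s => Lam (swapv x y z) (swap x y s)
  | App s t => App (swap x y s) (swap x y t)
  | Prob s t => Prob (swap x y s) (swap x y t)
  | Let e s => Let [seq (swapv x y b.1, swap x y b.2) | b <- e] (swap x y s)
  end.

Fixpoint holes (s : term H) : seq H :=
  match s with
  | Hole h => [:: h]
  | Var _ => [::]
  | Lam _ s => holes s
  | App s t | Prob s t => holes s ++ holes t
  | Let e s => flatten [seq holes b.2 | b <- e] ++ holes s
  end.

Fixpoint plug (H' : Type) (C : term H) (f : H -> term H') : term H' :=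
  match C with
  | Hole h => f h
  | Var x => Var x
  | Lam x s => Lam x (plug s f)
  | App s t => App (plug s f) (plug t f)
  | Prob s t => Prob (plug s f) (plug t f)
  | Let e s => Let [seq (b.1, plug b.2 f) | b <- e] (plug s f)
  end.

End Terms.

Definition is_multicontext (n : nat) (C : term 'I_n) : Prop :=
  wf C /\ forall i, count_mem i (holes C) = 1.

(* Alpha-equivalence together with reordering of the bindings of a let, as
   environments are multisets. *)
Inductive aeq : expr -> expr -> Prop :=
| aeq_refl s : aeq s s
| aeq_sym s t : aeq s t -> aeq t s
| aeq_trans s t r : aeq s t -> aeq t r -> aeq s r
| aeq_rename_lam x y s :
    y \notin fv s -> aeq (Lam x s) (Lam y (swap x y s))
| aeq_rename_let x y e s :
    x \in dom e -> y \notin dom e -> y \notin fv (Let e s) ->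
    aeq (Let e s) (swap x y (Let e s))
| aeq_perm e e' s : perm_eq e e' -> aeq (Let e s) (Let e' s)
| aeq_lam x s s' : aeq s s' -> aeq (Lam x s) (Lam x s')
| aeq_app s s' t t' : aeq s s' -> aeq t t' -> aeq (App s t) (App s' t')
| aeq_prob s s' t t' : aeq s s' -> aeq t t' -> aeq (Prob s t) (Prob s' t')
| aeq_let_in e s s' : aeq s s' -> aeq (Let e s) (Let e s')
| aeq_let_bind x t t' e s :
    aeq t t' -> aeq (Let ((x, t) :: e) s) (Let ((x, t') :: e) s).

Definition aeqb : rel expr := fun s t => `[< aeq s t >].

Lemma aeqb_refl : reflexive aeqb.
Proof. by move=> s; apply/asboolP; exact: aeq_refl. Qed.

Lemma aeqb_sym : symmetric aeqb.
Proof. by move=> s t; apply/asboolP/asboolP; exact: aeq_sym. Qed.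

Lemma aeqb_trans : transitive aeqb.
Proof.
move=> t s r /asboolP st /asboolP tr; apply/asboolP; exact: aeq_trans st tr.
Qed.

Canonical aeqb_equiv := EquivRel aeqb aeqb_refl aeqb_sym aeqb_trans.

Definition aexpr := {eq_quot aeqb}.
HB.instance Definition _ := Choice.on aexpr.
HB.instance Definition _ := EqQuotient.on aexpr.

(* The distinct variable convention. *)
Definition dvc (s : expr) : bool :=
  uniq (bv s) && all (fun x => x \notin fv s) (bv s).

Inductive actx : Type :=
| AHole
| AApp of actx & expr.

Fixpoint fillA (A : actx) (s : expr) : expr :=
  match A with
  | AHole => s
  | AApp A t => App (fillA A s) t
  end.

Fixpoint wf_actx (A : actx) : bool :=
  match A with
  | AHole => true
  | AApp A t => wf_actx A && wf t
  end.

(* For c = [:: (x_1, A_1); ...; (x_n, A_n)] and y playing the role of x_(n+1):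
   [first c y] is x_1 and [links c y] is {x_i = A_i[x_(i+1)]} for 1 <= i <= n. *)
Definition first (c : seq (var * actx)) (y : var) : var :=
  if c is (x, _) :: _ then x else y.

Fixpoint links (c : seq (var * actx)) (y : var) : env void :=
  match c with
  | [::] => [::]
  | (x, A) :: c => (x, fillA A (Var (first c y))) :: links c y
  end.

Definition vchain (xs : seq var) : seq (var * actx) := [seq (x, AHole) | x <- xs].

(* [RChain e c y B A] is
   let e, {x_i = A_i[x_(i+1)]}_(1 <= i <= n), y = B in A[x_1]
   where c lists the (x_i, A_i), y is x_(n+1) and B is A_(n+1). *)
Inductive rctx : Type :=
| RApp of actx
| RLet of env void & actx
| RChain of env void & seq (var * actx) & var & actx & actx.

Definition fillR (R : rctx) (s : expr) : expr :=
  match R with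
  | RApp A => fillA A s
  | RLet e A => Let e (fillA A s)
  | RChain e c y B A =>
      Let (e ++ links c y ++ [:: (y, fillA B s)]) (fillA A (Var (first c y)))
  end.

Definition wf_rctx (R : rctx) : bool :=
  match R with
  | RApp A => wf_actx A
  | RLet e A => [&& uniq (dom e), all (fun b => wf b.2) e & wf_actx A]
  | RChain e c y B A =>
      [&& uniq (dom e ++ dom c ++ [:: y]), all (fun b => wf b.2) e,
          all (fun b => wf_actx b.2) c, wf_actx B & wf_actx A]
  end.

Inductive rule : Type :=
  Lbeta | Probl | Probr | Lapp | LletIn | LletE | CpIn | CpE.

HB.instance Definition _ := gen_eqMixin rule.
HB.instance Definition _ := gen_choiceMixin rule.

(* The rules on representatives; [sr] only applies them to sources satisfying
   the distinct variable convention. *)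
Inductive red : rule -> expr -> expr -> Prop :=
| red_lbeta R x s t :
    red Lbeta (fillR R (App (Lam x s) t)) (fillR R (Let [:: (x, t)] s))
| red_probl R s t : red Probl (fillR R (Prob s t)) (fillR R s)
| red_probr R s t : red Probr (fillR R (Prob s t)) (fillR R t)
| red_lapp R e s t :
    red Lapp (fillR R (App (Let e s) t)) (fillR R (Let e (App s t)))
| red_llet_in e1 e2 s : red LletIn (Let e1 (Let e2 s)) (Let (e1 ++ e2) s)
| red_llet_e c x e1 s e2 A :
    red LletE
      (Let (links c x ++ (x, Let e1 s) :: e2) (fillA A (Var (first c x))))
      (Let (links c x ++ (x, s) :: e1 ++ e2) (fillA A (Var (first c x))))
| red_cp_in xs x y s e A :
    red CpIn
      (Let (links (vchain xs) x ++ (x, Lam y s) :: e)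
           (fillA A (Var (first (vchain xs) x))))
      (Let (links (vchain xs) x ++ (x, Lam y s) :: e)
           (fillA A (Lam y s)))
| red_cp_e c x B ys y z s e A :
    B <> AHole ->
    red CpE
      (Let (links c x ++ (x, fillA B (Var (first (vchain ys) y))) ::
            links (vchain ys) y ++ (y, Lam z s) :: e)
           (fillA A (Var (first c x))))
      (Let (links c x ++ (x, fillA B (Lam z s)) ::
            links (vchain ys) y ++ (y, Lam z s) :: e)
           (fillA A (Var (first c x)))).

Definition sr (r : rule) (u v : aexpr) : Prop :=
  exists s t : expr, [/\ u = \pi_aexpr s, v = \pi_aexpr t, dvc s & red r s t].

Definition whnf (u : aexpr) : Prop :=
  (exists x s, u = \pi_aexpr (Lam x s)) \/
  (exists e x s, u = \pi_aexpr (Let e (Lam x s))).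

(* Steps are recorded together with the rule used, so the two reductions of
   s (+) s give different evaluations. *)
Fixpoint is_evaluation (u : aexpr) (p : seq (rule * aexpr)) : Prop :=
  match p with
  | [::] => whnf u
  | (r, v) :: p => sr r u v /\ is_evaluation v p
  end.

Definition is_prob (r : rule) : bool :=
  match r with Probl | Probr => true | _ => false end.

Definition prob_length (p : seq (rule * aexpr)) : nat :=
  count (fun b => is_prob b.1) p.

Section ExpectedConvergence.
Variable F : realType.
Local Open Scope classical_set_scope.
Local Open Scope ring_scope.

Definition ExCv (s : expr) : \bar F :=
  \esum_(p in [set p | is_evaluation (\pi_aexpr s) p])
     (2 ^- prob_length p : F)%:E.

Definition ExCvk (s : expr) (k : nat) : \bar F :=
  \esum_(p in [set p | is_evaluation (\pi_aexpr s) p /\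
                       (prob_length p <= k)%N])
     (2 ^- prob_length p : F)%:E.

End ExpectedConvergence.

(* Main.v *)
(* Two terms C[s_1, ..., s_n] and C[t_1, ..., t_n] reduce in lockstep as long as
   no hole is in evaluation position: the same rule applies to both, possibly
   copying holes and renaming their contents. When a hole j is in evaluation
   position, C[t_1, ..., [.]_j, ..., t_n] is a reduction context; filling hole j
   with s_j leaves fewer holes, and the hypothesis then replaces s_j by t_j.
   Hence, by induction on N and on the number of holes, the evaluations of
   C[s_1, ..., s_n] of length at most N contribute at most
   ExCv(C[t_1, ..., t_n], d) for some d, and N tends to infinity.

   To work with named terms, a step of an equivalence class is moved to a chosen
   representative: two alpha-equivalent terms obeying the distinct variable
   convention, with disjoint binders, differ by one permutation of names that
   fixes the free names, and by the order of bindings. *)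
From HB Require Import structures.
From mathcomp Require Import all_boot all_order all_algebra generic_quotient zify.
From mathcomp Require Import boolp classical_sets cardinality fsbigop reals ereal esum.
Require Import Defs.

Set Implicit Arguments.
Unset Strict Implicit.
Unset Printing Implicit Defensive.

Import Order.TTheory GRing.Theory Num.Theory.

(** The induction is lexicographic: copying an abstraction may multiply the holes but costs one of
    the [N] steps, whereas replacing [t_j] by [s_j] on the right costs no step but lowers the number
    of holes. The offset of the hypothesis depends on [k] and on [R], so the full sums cannot be
    compared at once; each stage has at most two successors, so the maximum of their offsets is
    finite. The left-hand sum is cut by the number of all steps, because prob-length alone gives no
    induction over the other steps.

    Changing representatives renames names around and inside the holes, so the pairs in the holes
    must be closed under permutations of names. They are, since expected convergence is invariant
    under permutations and these also act on reduction contexts. One simulation argument serves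
    twice: with no pairs at all, its relation is identity up to the order of bindings, and it
    transports steps between representatives of one class. Determinism up to the choice between
    [Probl] and [Probr] reduces the evaluations of a term to those of its one or two successors. *)

Lemma term_env_ind (H : Type) (P : term H -> Prop) :
    (forall h, P (Hole h)) -> (forall x, P (Var x)) ->
    (forall x s, P s -> P (Lam x s)) ->
    (forall s t, P s -> P t -> P (App s t)) ->
    (forall s t, P s -> P t -> P (Prob s t)) ->
    (forall e s, (forall x t, (x, t) \in e -> P t) -> P s -> P (Let e s)) ->
  forall s, P s.
Proof.
move=> Ph Pv Pl Pa Pp Pe; fix IH 1 => -[h|x|x s|s t|s t|e s].
- exact: Ph.
- exact: Pv.
- exact: Pl.
- exact: Pa.
- exact: Pp.
(* [Let] nests [term] under [seq], so the hypotheses for the bindings are gathered by an inner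
   recursion on [e], where each call [IH u] is visibly on a subterm. Membership is dealt with
   afterwards. *)
- have: foldr (fun b Q => P b.2 /\ Q) True e.
    elim: e => [|[y u] e IHe]; [exact: I|exact: conj (IH u) IHe].
  move=> Qe; apply: Pe (IH s); move: Qe; clear.
  elim: e => [|[y u] e IHe] // [Pu /IHe Pe] x t.
  by rewrite inE => /orP[/eqP[_ ->]|/Pe].
Qed.

Lemma expr_ind (P : expr -> Prop) :
    (forall x, P (Var x)) ->
    (forall x s, P s -> P (Lam x s)) ->
    (forall s t, P s -> P t -> P (App s t)) ->
    (forall s t, P s -> P t -> P (Prob s t)) ->
    (forall e s, (forall x t, (x, t) \in e -> P t) -> P s -> P (Let e s)) ->
  forall s, P s.
Proof. by move=> *; apply: term_env_ind => // -[]. Qed.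

Lemma domP (e : env void) x : reflect (exists t, (x, t) \in e) (x \in dom e).
Proof.
apply: (iffP mapP) => [[[y t] yt /= ->]|[t xt]]; first by exists t.
by exists (x, t).
Qed.

Lemma dom_cat (T : Type) (e e' : seq (var * T)) : dom (e ++ e') = dom e ++ dom e'.
Proof. exact: map_cat. Qed.

Lemma perm_dom (e e' : env void) : perm_eq e e' -> perm_eq (dom e) (dom e').
Proof. exact: perm_map. Qed.

Lemma mem_fv_env (e : env void) x :
  reflect (exists y t, (y, t) \in e /\ x \in fv t)
          (x \in flatten [seq fv b.2 | b <- e]).
Proof.
apply: (iffP flatten_mapP) => [[[y t] yt xt]|[y [t [yt xt]]]]; first by exists y, t.
by exists (y, t).
Qed.

Lemma mem_bv_env (e : env void) x :
  reflect (exists y t, (y, t) \in e /\ x \in bv t)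
          (x \in flatten [seq bv b.2 | b <- e]).
Proof.
apply: (iffP flatten_mapP) => [[[y t] yt xt]|[y [t [yt xt]]]]; first by exists y, t.
by exists (y, t).
Qed.

Lemma fv_letP (e : env void) s x :
  reflect (x \notin dom e /\ ((exists y t, (y, t) \in e /\ x \in fv t) \/ x \in fv s))
          (x \in fv (Let e s)).
Proof.
rewrite /= mem_filter mem_cat; apply: (iffP andP) => -[xe xs]; split=> //.
  by case/orP: xs => [/mem_fv_env|]; [left|right].
by case: xs => [/mem_fv_env ->|->]; rewrite ?orbT.
Qed.

(** * Renamings and permutations of names *)

Fixpoint ren (f : var -> var) (s : expr) : expr :=
  match s with
  | Hole h => Hole h
  | Var z => Var (f z)
  | Lam z s => Lam (f z) (ren f s)
  | App s t => App (ren f s) (ren f t)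
  | Prob s t => Prob (ren f s) (ren f t)
  | Let e s => Let [seq (f b.1, ren f b.2) | b <- e] (ren f s)
  end.

Definition renE f (e : env void) := [seq (f b.1, ren f b.2) | b <- e].

Lemma ren_let f e s : ren f (Let e s) = Let (renE f e) (ren f s).
Proof. by []. Qed.

Lemma dom_renE f e : dom (renE f e) = map f (dom e).
Proof. by rewrite /dom /renE -!map_comp. Qed.

Lemma swap_ren x y (s : expr) : swap x y s = ren (swapv x y) s.
Proof.
elim/expr_ind: s => //= [z s ->|s t -> ->|s t -> ->|e s IHe ->] //.
by congr Let; apply/eq_in_map => -[z t] /IHe ->.
Qed.

Lemma ren_comp f g s : ren f (ren g s) = ren (f \o g) s.
Proof.
elim/expr_ind: s => //= [z s ->|s t -> ->|s t -> ->|e s IHe ->] //.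
by congr Let; rewrite -map_comp; apply/eq_in_map => -[z t] /IHe /= ->.
Qed.

Lemma renE_comp f g e : renE f (renE g e) = renE (f \o g) e.
Proof.
by rewrite /renE -map_comp; apply/eq_map => -[z t] /=; rewrite ren_comp.
Qed.

Lemma ren_eq_in f g s :
  {in fv s, f =1 g} -> {in bv s, f =1 g} -> ren f s = ren g s.
Proof.
elim/expr_ind: s => //= [z F _|z s IHs F B|s t IHs IHt F B|s t IHs IHt F B|e s IHe IHs F B].
- by rewrite F ?inE.
- rewrite B ?mem_head ?IHs // => w ws; last by rewrite B ?inE ?ws ?orbT.
  have [->|wz] := eqVneq w z; first by rewrite B ?mem_head.
  by rewrite F // mem_filter wz.
- by rewrite IHs ?IHt // => w ww; [apply: F|apply: B|apply: F|apply: B];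
    rewrite mem_cat ww ?orbT.
- by rewrite IHs ?IHt // => w ww; [apply: F|apply: B|apply: F|apply: B];
    rewrite mem_cat ww ?orbT.
- have FF w t : (exists y, (y, t) \in e) \/ t = s -> w \in fv t -> f w = g w.
    move=> yt wt; have [we|we] := boolP (w \in dom e).
      by rewrite B // mem_cat we.
    apply: F; rewrite mem_filter we mem_cat; apply/orP.
    case: yt => [[y yt]|<-]; last by right.
    by left; apply/mem_fv_env; exists y, t.
  congr Let; last first.
    by apply: IHs => w ws; [apply: (FF w s) => //; right|rewrite B // !mem_cat ws !orbT].
  apply/eq_in_map => -[y t] yt /=; congr pair.
    by rewrite B // mem_cat; apply/orP; left; apply/domP; exists t.
  apply: (IHe _ _ yt) => w wt; first by apply: (FF w t) => //; left; exists y.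
  rewrite B // !mem_cat; apply/orP; right; apply/orP; left.
  by apply/mem_bv_env; exists y, t.
Qed.

Lemma ren_id_in f s :
  {in fv s, forall x, f x = x} -> {in bv s, forall x, f x = x} -> ren f s = s.
Proof.
move=> F B; rewrite (ren_eq_in (g := id)) => //.
elim/expr_ind: s {F B} => //= [z s ->|s t -> ->|s t -> ->|e s IHe ->] //.
congr Let; rewrite -[RHS]map_id; apply/eq_in_map => -[z t] /IHe /= -> //.
Qed.

Lemma bv_ren f s : bv (ren f s) = map f (bv s).
Proof.
elim/expr_ind: s => //= [z s ->|s t -> ->|s t -> ->|e s IHe ->] //; rewrite ?map_cat //.
congr (_ ++ (_ ++ _)); first exact: dom_renE.
rewrite map_flatten -!map_comp; congr flatten; apply/eq_in_map => -[z t] /IHe /= -> //.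
Qed.

Lemma fv_ren f s : injective f -> fv (ren f s) = map f (fv s).
Proof.
move=> fI; elim/expr_ind: s => //= [z s ->|s t -> ->|s t -> ->|e s IHe ->] //; rewrite ?map_cat //.
  by rewrite filter_map; congr map; apply: eq_filter => w /=; rewrite inj_eq.
have -> : flatten [seq fv b.2 | b <- [seq (f b.1, ren f b.2) | b <- e]]
        = map f (flatten [seq fv b.2 | b <- e]).
  by rewrite map_flatten -!map_comp; congr flatten; apply/eq_in_map => -[z t] /IHe /= -> //.
rewrite -map_cat filter_map; congr map; apply: eq_filter => w /=.
by rewrite -/(renE f e) dom_renE mem_map.
Qed.

Lemma swapv_inj x y : injective (swapv x y).
Proof. by move=> u v; rewrite /swapv; do !case: eqP; lia. Qed.

Lemma swapvK x y : involutive (swapv x y).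
Proof. by move=> u; rewrite /swapv; do !case: eqP; lia. Qed.

Lemma swapv_comp f x y z : injective f ->
  f (swapv x y z) = swapv (f x) (f y) (f z).
Proof. by move=> fI; rewrite /swapv !inj_eq //; do !case: ifP. Qed.

Lemma ren_swap f x y s : injective f ->
  ren f (swap x y s) = swap (f x) (f y) (ren f s).
Proof.
move=> fI; rewrite !swap_ren !ren_comp.
by apply: ren_eq_in => z _ /=; exact: swapv_comp.
Qed.

(* Products of transpositions, applied from right to left. *)
Definition prm := seq (var * var).
Definition pv (p : prm) (z : var) : var := foldr (fun b z => swapv b.1 b.2 z) z p.
Definition pt (p : prm) (s : expr) : expr := ren (pv p) s.
Definition ptE (p : prm) (e : env void) := renE (pv p) e.

Lemma pv_inj p : injective (pv p).
Proof. by elim: p => //= b p IH u v /swapv_inj/IH. Qed.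
#[local] Hint Resolve pv_inj swapv_inj : core.

Lemma pv_cat p q z : pv (p ++ q) z = pv p (pv q z).
Proof. by rewrite /pv foldr_cat. Qed.

Lemma pt_cat p q s : pt (p ++ q) s = pt p (pt q s).
Proof. by rewrite /pt ren_comp; apply: ren_eq_in => z _ /=; rewrite pv_cat. Qed.

Lemma pt_cons x y p s : pt ((x, y) :: p) s = swap x y (pt p s).
Proof. by rewrite swap_ren /pt ren_comp; apply: ren_eq_in. Qed.

Lemma pt_nil s : pt [::] s = s.
Proof. by rewrite /pt ren_id_in. Qed.

Lemma ptE_nil e : ptE [::] e = e.
Proof.
rewrite /ptE /renE -[RHS]map_id; apply: eq_map => -[x t] /=; congr pair.
exact: pt_nil.
Qed.

Lemma pv_revK p z : pv (rev p) (pv p z) = z.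
Proof.
elim: p z => //= -[x y] p IH z; rewrite rev_cons -cats1 pv_cat /=.
by rewrite swapvK IH.
Qed.

Lemma pt_revK p s : pt (rev p) (pt p s) = s.
Proof. by rewrite /pt ren_comp ren_id_in // => z _ /=; rewrite pv_revK. Qed.

Lemma ptE_comp p q e : ptE p (ptE q e) = ptE (p ++ q) e.
Proof.
rewrite /ptE renE_comp /renE; apply: eq_map => -[x t] /=; rewrite pv_cat; congr pair.
by rewrite -ren_comp -/(pt q t) -/(pt p _) -pt_cat.
Qed.

Lemma ptE_revK p e : ptE (rev p) (ptE p e) = e.
Proof.
rewrite /ptE renE_comp /renE -[RHS]map_id; apply: eq_map => -[x t] /=.
by rewrite pv_revK -ren_comp; congr pair; exact: pt_revK.
Qed.

Lemma dom_ptE p e : dom (ptE p e) = map (pv p) (dom e).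
Proof. exact: dom_renE. Qed.

(** * Alpha-equivalence *)

(** Names and order are fixed here. Reordering is kept apart as a [perm_eq], and [eqE_perm] commutes
    the two. *)
Inductive eqE : env void -> env void -> Prop :=
| eqE_nil : eqE [::] [::]
| eqE_cons x t t' e e' : aeq t t' -> eqE e e' -> eqE ((x, t) :: e) ((x, t') :: e').

Lemma eqE_map f g h k (e : env void) :
  (forall x t, (x, t) \in e -> f x = h x /\ aeq (g t) (k t)) ->
  eqE [seq (f b.1, g b.2) | b <- e] [seq (h b.1, k b.2) | b <- e].
Proof.
elim: e => [_|[x t] e IH E] /=; first exact: eqE_nil.
have [-> gk] := E x t (mem_head _ _); constructor=> //.
by apply: IH => y u yu; apply: E; rewrite inE yu orbT.
Qed.

Lemma eqE_refl e : eqE e e.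
Proof. by elim: e => [|[x t] e IH]; constructor=> //; exact: aeq_refl. Qed.

Lemma eqE_sym e e' : eqE e e' -> eqE e' e.
Proof. by elim=> [|x t t' {}e {}e' tt' _ IH]; constructor=> //; exact: aeq_sym. Qed.

Lemma eqE_trans e e' e'' : eqE e e' -> eqE e' e'' -> eqE e e''.
Proof.
move=> E; elim: E e'' => [|x t t' {}e {}e' tt' _ IH] e'' E'; inversion_clear E'.
  exact: eqE_nil.
by constructor; [exact: aeq_trans tt' H|exact: IH].
Qed.

Lemma eqE_dom e e' : eqE e e' -> dom e = dom e'.
Proof. by elim=> //= x t t' {}e {}e' _ _; rewrite /dom /= => ->. Qed.

Lemma eqE_cat e1 e1' e2 e2' : eqE e1 e1' -> eqE e2 e2' -> eqE (e1 ++ e2) (e1' ++ e2').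
Proof. by elim=> //= x t t' e e' tt' _ IH /IH; constructor. Qed.

Lemma eqE_catl e1 e2 e' : eqE (e1 ++ e2) e' ->
  exists e1' e2', [/\ e' = e1' ++ e2', eqE e1 e1' & eqE e2 e2'].
Proof.
elim: e1 e' => [|[x t] e1 IH] e' /= E; first by exists [::], e'; split=> //; exact: eqE_nil.
inversion_clear E; have [e1' [e2' [-> E1 E2]]] := IH _ H0.
by exists ((x, t') :: e1'), e2'; split=> //; constructor.
Qed.

Lemma eqE_perm e1 e2 e1' : eqE e1 e1' -> perm_eq e1 e2 ->
  exists2 e2', eqE e2 e2' & perm_eq e1' e2'.
Proof.
move=> E; elim: E e2 => [|x t t' {}e1 {}e1' tt' _ IH] e2.
  by move/perm_size => /esym/size0nil ->; exists [::] => //; exact: eqE_nil.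
move=> P; have: (x, t) \in e2 by rewrite -(perm_mem P) mem_head.
move=> xe2; case/splitPr: xe2 P => u v P.
have {}P: perm_eq e1 (u ++ v).
  by move: P; rewrite perm_sym -cat1s perm_catCA /= perm_cons perm_sym.
have [w /eqE_catl [u' [v' [-> uu' vv']]] P'] := IH _ P.
exists (u' ++ (x, t') :: v'); first by apply: eqE_cat => //; constructor.
by rewrite perm_sym -cat1s perm_catCA /= perm_cons perm_sym.
Qed.

Lemma aeq_let (e e' : env void) s s' :
  eqE e e' -> aeq s s' -> aeq (Let e s) (Let e' s').
Proof.
move=> ee' ss'; apply: (aeq_trans (aeq_let_in e ss')) => {ss' s}.
(* [aeq_let_bind] rewrites only the head binding, so every other one is moved to the front past the
   prefix [l] and back. *)
suff: forall l, aeq (Let (l ++ e) s') (Let (l ++ e') s') by move/(_ [::]).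
elim: ee' => [|x t t' {}e {}e' tt' _ IH] l; first exact: aeq_refl.
have := IH (rcons l (x, t)); rewrite !cat_rcons => H; apply: aeq_trans H _.
apply: (@aeq_trans _ (Let ((x, t) :: l ++ e') s')).
  by apply: aeq_perm; rewrite -cat1s perm_catCA.
apply: aeq_trans (aeq_let_bind _ _ _ tt') _.
by apply: aeq_perm; rewrite perm_sym -cat1s perm_catCA.
Qed.

Lemma mem_map_swapv x y z l : (z \in map (swapv x y) l) = (swapv x y z \in l).
Proof. by rewrite -{1}[z](swapvK x y) mem_map. Qed.

Lemma swapv_l x y : swapv x y x = y.
Proof. by rewrite /swapv eqxx. Qed.

Lemma swapv_r x y : swapv x y y = x.
Proof. by rewrite /swapv eqxx; case: eqP. Qed.

Lemma swapv_out x y z : z != x -> z != y -> swapv x y z = z.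
Proof. by rewrite /swapv => /negbTE -> /negbTE ->. Qed.

Lemma aeq_fv s t : aeq s t -> fv s =i fv t.
Proof.
elim=> {s t} //.
- by move=> s t _ IH z; rewrite IH.
- by move=> s t r _ IH1 _ IH2 z; rewrite IH1.
- move=> x y s ys z; rewrite swap_ren /= !mem_filter fv_ren // mem_map_swapv.
  have [->|zx] := eqVneq z x; first by rewrite swapv_l (negbTE ys) andbF.
  have [->|zy] := eqVneq z y; first by rewrite (negbTE ys) andbF.
  by rewrite swapv_out.
- move=> x y e s xe _ ys z; rewrite swap_ren fv_ren // mem_map_swapv.
  have xs: x \notin fv (Let e s) by apply/fv_letP; rewrite xe => -[].
  have [->|zx] := eqVneq z x; first by rewrite swapv_l (negbTE ys) (negbTE xs).
  have [->|zy] := eqVneq z y; first by rewrite swapv_r (negbTE ys) (negbTE xs).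
  by rewrite swapv_out.
- move=> e e' s P z; rewrite /= !mem_filter !mem_cat (perm_mem (perm_dom P)).
  by congr (_ && (_ || _)); apply/mem_fv_env/mem_fv_env => -[y [t yt]]; exists y, t;
    move: yt; rewrite (perm_mem P).
- by move=> x s s' _ IH z; rewrite /= !mem_filter IH.
- by move=> s s' t t' _ IH1 _ IH2 z; rewrite /= !mem_cat IH1 IH2.
- by move=> s s' t t' _ IH1 _ IH2 z; rewrite /= !mem_cat IH1 IH2.
- by move=> e s s' _ IH z; rewrite /= !mem_filter !mem_cat IH.
- by move=> x t t' e s _ IH z; rewrite /= !mem_filter !mem_cat IH.
Qed.

Lemma aeq_ren f s t : injective f -> aeq s t -> aeq (ren f s) (ren f t).
Proof.
move=> fI; elim=> {s t}.
- by move=> *; exact: aeq_refl.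
- by move=> s t _; exact: aeq_sym.
- by move=> s t r _ + _; exact: aeq_trans.
- move=> x y s ys; rewrite [X in aeq _ X]/= ren_swap //; apply: aeq_rename_lam.
  by rewrite fv_ren // mem_map.
- move=> x y e s xe ye ys; rewrite ren_swap // ren_let.
  apply: aeq_rename_let; rewrite ?dom_renE ?mem_map //.
  by rewrite -ren_let fv_ren // mem_map.
- by move=> e e' s P; apply: aeq_perm; exact: perm_map.
- by move=> *; exact: aeq_lam.
- by move=> *; exact: aeq_app.
- by move=> *; exact: aeq_prob.
- by move=> *; exact: aeq_let_in.
- by move=> *; exact: aeq_let_bind.
Qed.

Lemma fresh_seq (X : seq var) n :
  exists ys : seq var, [/\ size ys = n, uniq ys & forall y, y \in ys -> y \notin X].
Proof.
exists (iota (\max_(x <- X) x).+1 n); split; rewrite ?size_iota ?iota_uniq //.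
move=> y; rewrite mem_iota => /andP[+ _]; apply: contraTN => yX.
by rewrite -leqNgt; exact: (@leq_bigmax_seq _ X xpredT id y).
Qed.

Lemma pv_zip_out xs ys z : z \notin xs -> z \notin ys -> pv (zip xs ys) z = z.
Proof.
elim: xs ys => [[]|x xs IH [|y ys]] //=; rewrite !inE !negb_or.
by move=> /andP[? ?] /andP[? ?]; rewrite IH // swapv_out.
Qed.

Lemma pv_zip_in xs ys z : uniq xs -> uniq ys -> size xs = size ys ->
  (forall y, y \in ys -> y \notin xs) -> z \in xs ->
  pv (zip xs ys) z = nth 0 ys (index z xs).
Proof.
elim: xs ys => [[]|x xs IH [|y ys]] //= /andP[xxs uxs] /andP[yys uys] [sz] D.
have [zx _|zx] := eqVneq x z.
  subst x; rewrite pv_zip_out ?swapv_l //.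
  by apply/negP => zys; have := D z; rewrite !inE zys orbT eqxx => /(_ isT).
rewrite inE eq_sym (negbTE zx) /= => zxs.
have D' w : w \in ys -> w \notin xs.
  by move=> wys; have := D w; rewrite !inE wys orbT negb_or => /(_ isT) /andP[].
rewrite IH // swapv_out //.
  apply/eqP => E; have := D x; rewrite -E !inE mem_nth ?orbT ?eqxx => [/(_ isT)|] //.
  by rewrite -sz index_mem.
apply: contraNneq yys => <-; by rewrite mem_nth // -sz index_mem.
Qed.

(** [aeq_rename_let] swaps one binder at a time. The transpositions in [zip xs ys] act on disjoint
    names, so those already applied leave the next [x] and [y] alone and the next swap is again a
    legal renaming. *)
Lemma aeq_let_freshen xs ys e s : uniq xs -> uniq ys -> size xs = size ys ->
  {subset xs <= dom e} ->
  (forall y, y \in ys -> y \notin dom e /\ y \notin fv (Let e s)) ->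
  aeq (Let e s) (pt (zip xs ys) (Let e s)).
Proof.
elim: xs ys => [[]|x xs IH [|y ys]] //= => [_ _ _ _ _|]; first by rewrite pt_nil; exact: aeq_refl.
move=> /andP[xxs uxs] /andP[yys uys] [sz] xse yse.
have H: aeq (Let e s) (pt (zip xs ys) (Let e s)).
  by apply: IH => // w ww; [apply: xse|apply: yse]; rewrite inE ww orbT.
apply: aeq_trans H _; rewrite pt_cons.
have xe : x \in dom e by apply: xse; rewrite mem_head.
have [ye yf] := yse y (mem_head _ _).
have pvx : pv (zip xs ys) x = x.
  by rewrite pv_zip_out //; apply: contraL xe => xy; have [] := yse x; rewrite // inE xy orbT.
have pvy : pv (zip xs ys) y = y.
  by rewrite pv_zip_out //; apply: contra ye => yx; apply: xse; rewrite inE yx orbT.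
rewrite [pt _ _]/pt ren_let; apply: aeq_rename_let.
- by rewrite dom_renE -pvx mem_map.
- by rewrite dom_renE -pvy mem_map.
- by rewrite -ren_let fv_ren // -pvy mem_map.
Qed.

(** Under a binder, [f x] and [g x] may differ. Both are swapped with one common fresh name; the
    composed renamings then agree on the free names of the body, and the induction hypothesis
    applies to them. *)
Lemma aeq_ren_agree f g s : injective f -> injective g -> {in fv s, f =1 g} ->
  aeq (ren f s) (ren g s).
Proof.
elim/expr_ind: s f g => [x|x s IH|s t IHs IHt|s t IHs IHt|e s IHe IHs] f g fI gI /= A.
- by rewrite A ?mem_head //; exact: aeq_refl.
- have [[|z l] [] //= _ _ Z] := fresh_seq (f x :: g x :: fv (ren f s) ++ fv (ren g s)) 1.
  have {Z} := Z z (mem_head _ _); rewrite !inE !mem_cat !negb_or => /and4P[zf zg zfs zgs].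
  apply: aeq_trans (aeq_rename_lam (f x) zfs) _.
  apply: aeq_sym; apply: aeq_trans (aeq_rename_lam (g x) zgs) _; apply: aeq_sym.
  apply: aeq_lam; rewrite !swap_ren !ren_comp; apply: IH.
  + exact: inj_comp.
  + exact: inj_comp.
  move=> w ws /=; have [->|wx] := eqVneq w x; first by rewrite !swapv_l.
  rewrite fv_ren // in zfs; rewrite fv_ren // in zgs.
  have zfw: f w != z by apply: contraNneq zfs => <-; exact: map_f.
  have zgw: g w != z by apply: contraNneq zgs => <-; exact: map_f.
  rewrite !swapv_out ?inj_eq //; apply: A; by rewrite mem_filter wx.
- by apply: aeq_app; [apply: IHs|apply: IHt] => // w ww; apply: A; rewrite mem_cat ww ?orbT.
- by apply: aeq_prob; [apply: IHs|apply: IHt] => // w ww; apply: A; rewrite mem_cat ww ?orbT.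
rewrite -/(renE f e) -/(renE g e).
(* [dom e] may have repetitions here, whereas [aeq_let_freshen] asks for a duplicate-free list. *)
pose xs := undup (dom e).
have [ys [sz uys Y]] := fresh_seq (map f (dom e) ++ map g (dom e) ++
  fv (Let (renE f e) (ren f s)) ++ fv (Let (renE g e) (ren g s)) ++
  map f (fv s) ++ map g (fv s) ++ map f (flatten [seq fv b.2 | b <- e])
    ++ map g (flatten [seq fv b.2 | b <- e])) (size xs).
pose p := zip (map f xs) ys; pose q := zip (map g xs) ys.
have uxs : uniq xs by exact: undup_uniq.
have Hf : aeq (Let (renE f e) (ren f s)) (pt p (Let (renE f e) (ren f s))).
  apply: aeq_let_freshen; rewrite ?map_inj_uniq ?size_map //.
    by move=> w /mapP[v]; rewrite mem_undup dom_renE => ve ->; exact: map_f.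
  by move=> y /Y; rewrite !mem_cat !negb_or dom_renE => /and5P[? ? ? ? _].
have Hg : aeq (Let (renE g e) (ren g s)) (pt q (Let (renE g e) (ren g s))).
  apply: aeq_let_freshen; rewrite ?map_inj_uniq ?size_map //.
    by move=> w /mapP[v]; rewrite mem_undup dom_renE => ve ->; exact: map_f.
  by move=> y /Y; rewrite !mem_cat !negb_or dom_renE => /and5P[? ? ? ? _].
apply: aeq_trans Hf _; apply: aeq_sym; apply: aeq_trans Hg _; apply: aeq_sym.
have agree w : (w \in dom e) || ((w \in flatten [seq fv b.2 | b <- e]) || (w \in fv s)) ->
    (pv p \o f) w = (pv q \o g) w.
  move=> /= wes; have [we|we] := boolP (w \in dom e).
    rewrite !pv_zip_in ?map_inj_uniq ?size_map ?mem_map ?mem_undup //.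
    - by rewrite !index_map.
    - move=> y /Y; rewrite !mem_cat !negb_or => /and3P[_ yg _].
      by apply: contra yg => /mapP[v]; rewrite mem_undup => ve ->; exact: map_f.
    - move=> y /Y; rewrite !mem_cat !negb_or => /and3P[yf _ _].
      by apply: contra yf => /mapP[v]; rewrite mem_undup => ve ->; exact: map_f.
  rewrite (negbTE we) /= in wes.
  have [fy gy] : f w \notin ys /\ g w \notin ys.
    by split; apply/negP => /Y; rewrite !mem_cat !mem_map //;
       case/orP: wes => ->; rewrite ?orbT.
  rewrite !pv_zip_out ?mem_map ?mem_undup //.
  by apply: A; rewrite mem_filter we mem_cat.
rewrite /pt !ren_let; apply: aeq_let.
  rewrite !renE_comp; apply: eqE_map => x t xt; split.
    by apply: agree; apply/orP; left; apply/domP; exists t.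
  rewrite -/ren; apply: (IHe x) => //; try exact: inj_comp.
  move=> w wt; apply: agree; apply/orP; right; apply/orP; left.
  by apply/mem_fv_env; exists x, t.
rewrite !ren_comp; apply: IHs; try exact: inj_comp.
by move=> w ws; apply: agree; rewrite ws !orbT.
Qed.

Lemma aeq_ren_id f s : injective f -> {in fv s, forall x, f x = x} -> aeq (ren f s) s.
Proof.
move=> fI F; have -> : aeq (ren f s) s = aeq (ren f s) (ren id s).
  by congr aeq; rewrite ren_id_in.
exact: aeq_ren_agree.
Qed.

(** One-level inversion of [aeq]. Symmetry and transitivity are constructors of [aeq], so inverting
    a derivation says nothing about the heads. This relation matches them, with the renaming of the
    top binders gathered in one permutation that fixes the free names. *)
Definition hrel (a b : expr) : Prop :=
  match a, b with
  | Var x, Var y => x = y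
  | Lam x s, Lam y s' => exists p, [/\ {in fv (Lam x s), forall z, pv p z = z},
      pv p x = y & aeq (pt p s) s']
  | App s t, App s' t' | Prob s t, Prob s' t' => aeq s s' /\ aeq t t'
  | Let e s, Let e' s' => exists p e1, [/\ {in fv (Let e s), forall z, pv p z = z},
      eqE (ptE p e) e1, perm_eq e1 e' & aeq (pt p s) s']
  | _, _ => False
  end.

Lemma eqE_ptE p e e' : eqE e e' -> eqE (ptE p e) (ptE p e').
Proof. by elim=> [|x t t' {}e {}e' tt' _ IH] /=; constructor=> //; apply: aeq_ren. Qed.

(** The permutations compose: symmetry is answered by [rev p] and transitivity by [q ++ p]. For
    [Let], the reordering is pushed past the pointwise part by [eqE_perm]. *)
Lemma aeq_hrel a b : aeq a b -> hrel a b.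
Proof.
elim=> {a b}.
- case=> [[]|x|x s|s t|s t|e s] //=.
  + by exists [::]; split=> //; rewrite pt_nil; exact: aeq_refl.
  + by split; exact: aeq_refl.
  + by split; exact: aeq_refl.
  + exists [::], e; split=> //; last by rewrite pt_nil; exact: aeq_refl.
    by rewrite ptE_nil; exact: eqE_refl.
- move=> s t st; case: s t st => [[]|x|x s|s1 s2|s1 s2|e s] [[]|x'|x' s'|s1' s2'|s1' s2'|e' s'] st //.
  + case=> p [F P A]; exists (rev p); rewrite -P pv_revK; split=> //.
      by move=> z; rewrite P -(aeq_fv st) => /F {1}<-; rewrite pv_revK.
    by rewrite -[s](pt_revK p); apply: aeq_ren => //; exact: aeq_sym.
  + by case=> ? ?; split; exact: aeq_sym.
  + by case=> ? ?; split; exact: aeq_sym.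
  + case=> p [e1 [F E P A]].
    have [e2 E2 P2] : exists2 e2, eqE e' e2 & perm_eq (ptE p e) e2.
      exact: eqE_perm (eqE_sym E) P.
    exists (rev p), (ptE (rev p) e2); split.
    * by move=> z; rewrite -(aeq_fv st) => /F {1}<-; rewrite pv_revK.
    * exact: eqE_ptE.
    * rewrite -[e](ptE_revK p); apply: perm_map; by rewrite perm_sym.
    * by rewrite -[s](pt_revK p); apply: aeq_ren => //; exact: aeq_sym.
- move=> s t r st + tr; case: s t r st tr => [[]|x|x s|s1 s2|s1 s2|e s]
    [[]|x'|x' s'|s1' s2'|s1' s2'|e' s'] [[]|x''|x'' s''|s1'' s2''|s1'' s2''|e'' s''] //= st tr.
  + by move=> ->.
  + case=> p [F P A] [q [F' P' A']]; exists (q ++ p); split.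
    * by move=> z zs; rewrite pv_cat F // F' // -(aeq_fv st).
    * by rewrite pv_cat P.
    * by rewrite pt_cat; apply: aeq_trans A'; apply: aeq_ren.
  + by case=> ? ? [? ?]; split; apply: aeq_trans; eauto.
  + by case=> ? ? [? ?]; split; apply: aeq_trans; eauto.
  + case=> p [e1 [F E P A]] [q [e1' [F' E' P' A']]].
    have [e2 E2 P2] : exists2 e2, eqE (ptE q e1) e2 & perm_eq e1' e2.
      by apply: eqE_perm E' _; apply: perm_map; rewrite perm_sym.
    exists (q ++ p), e2; split.
    * by move=> z zs; rewrite pv_cat F // F' // -(aeq_fv st).
    * by rewrite -ptE_comp; apply: eqE_trans E2; apply: eqE_ptE.
    * by apply: perm_trans P'; rewrite perm_sym.
    * by rewrite pt_cat; apply: aeq_trans A'; apply: aeq_ren.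
- move=> x y s ys; exists [:: (x, y)]; split; rewrite /= ?swapv_l //.
    move=> z; rewrite mem_filter => /andP[zx zs]; rewrite swapv_out //.
    by apply: contraNneq ys => <-.
  by rewrite swap_ren; exact: aeq_refl.
- move=> x y e s xe ye ys /=; exists [:: (x, y)], (ptE [:: (x, y)] e); split.
  + move=> z zs; rewrite /= swapv_out //.
      by apply: contraTneq zs => ->; apply/fv_letP; rewrite xe => -[].
    by apply: contraNneq ys => <-.
  + exact: eqE_refl.
  + by under [X in perm_eq _ X]eq_map do rewrite swap_ren.
  + by rewrite swap_ren; exact: aeq_refl.
- move=> e e' s P /=; exists [::], e; split=> //; last by rewrite pt_nil; exact: aeq_refl.
  by rewrite ptE_nil; exact: eqE_refl.
- by move=> x s s' A _; exists [::]; split=> //; rewrite pt_nil.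
- by [].
- by [].
- move=> e s s' A _; exists [::], e; split=> //; rewrite ?pt_nil ?ptE_nil //.
  exact: eqE_refl.
- move=> x t t' e s A _; exists [::], ((x, t') :: e); split=> //.
    by rewrite ptE_nil; constructor=> //; exact: eqE_refl.
  by rewrite pt_nil; exact: aeq_refl.
Qed.

Lemma wf_ren f s : injective f -> wf (ren f s) = wf s.
Proof.
move=> fI; elim/expr_ind: s => //= [s t -> ->|s t -> ->|e s IHe ->] //.
rewrite -/(renE f e) dom_renE map_inj_uniq // all_map; congr [&& _, _ & _].
by apply: eq_in_all => -[x v] /IHe.
Qed.

Lemma aeq_wf s t : aeq s t -> wf s = wf t.
Proof.
elim=> {s t} //=.
- by move=> s t r _ -> _ ->.
- by move=> x y s _; rewrite swap_ren wf_ren.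
- move=> x y e s _ _ _; have := wf_ren (Let e s) (@swapv_inj x y).
  by rewrite -swap_ren.
- move=> e e' s P; rewrite (perm_uniq (perm_dom P)); congr [&& _, _ & _].
  exact: perm_all.
- by move=> s s' t t' _ -> _ ->.
- by move=> s s' t t' _ -> _ ->.
- by move=> e s s' _ ->.
- by move=> x t t' e s _ ->.
Qed.

(** * Compatible closure *)

(* [crel S n a b]: a = C[s_1, ..., s_n] and b = C[t_1, ..., t_n] for some
   multicontext C and pairs (s_i, t_i) in S, up to the order of bindings in b. *)
Inductive crel (S : expr -> expr -> Prop) : nat -> expr -> expr -> Prop :=
| crel_hole s t : S s t -> crel S 1 s t
| crel_var x : crel S 0 (Var x) (Var x)
| crel_lam n x s s' : crel S n s s' -> crel S n (Lam x s) (Lam x s')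
| crel_app n m s s' t t' : crel S n s s' -> crel S m t t' ->
    crel S (n + m) (App s t) (App s' t')
| crel_prob n m s s' t t' : crel S n s s' -> crel S m t t' ->
    crel S (n + m) (Prob s t) (Prob s' t')
| crel_let n m e e1 e' s s' : crelE S n e e1 -> perm_eq e1 e' -> crel S m s s' ->
    crel S (n + m) (Let e s) (Let e' s')
with crelE (S : expr -> expr -> Prop) : nat -> env void -> env void -> Prop :=
| crelE_nil : crelE S 0 [::] [::]
| crelE_cons n m x t t' e e' : crel S n t t' -> crelE S m e e' ->
    crelE S (n + m) ((x, t) :: e) ((x, t') :: e').

Scheme crel_min := Minimality for crel Sort Prop
with crelE_min := Minimality for crelE Sort Prop.
Combined Scheme crel_crelE_ind from crel_min, crelE_min.

Section CompatibleClosure.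
Variable S : expr -> expr -> Prop.

Lemma crel_refl a : crel S 0 a a.
Proof.
elim/expr_ind: a => [x|x s IH|s t IHs IHt|s t IHs IHt|e s IHe IHs].
- exact: crel_var.
- exact: crel_lam.
- exact: (crel_app IHs IHt).
- exact: (crel_prob IHs IHt).
- apply: (@crel_let S 0 0 e e) => //; elim: e IHe => [_|[x t] e IH E]; first exact: crelE_nil.
  apply: (@crelE_cons S 0 0); first by apply: E (mem_head _ _).
  by apply: IH => y u yu; apply: (E y); rewrite inE yu orbT.
Qed.

Lemma crelE_dom n e e' : crelE S n e e' -> dom e = dom e'.
Proof. by elim=> // {}n m x t t' {}e {}e' _ _; rewrite /dom /= => ->. Qed.

Lemma crelE_cat n m e1 e1' e2 e2' : crelE S n e1 e1' -> crelE S m e2 e2' ->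
  crelE S (n + m) (e1 ++ e2) (e1' ++ e2').
Proof.
by move=> H H2; elim: H => //= {}n k x t t' e e' tt' _ IH; rewrite -addnA; constructor.
Qed.

Lemma crelE_catl n e1 e2 e' : crelE S n (e1 ++ e2) e' ->
  exists n1 n2 e1' e2',
    [/\ n = n1 + n2, e' = e1' ++ e2', crelE S n1 e1 e1' & crelE S n2 e2 e2'].
Proof.
elim: e1 n e' => [|[x t] e1 IH] n e' /= E.
  by exists 0, n, [::], e'; split=> //; exact: crelE_nil.
inversion E; subst; have [n1 [n2 [e1' [e2' [-> -> E1 E2]]]]] := IH _ _ H5.
by exists (n0 + n1), n2, ((x, t') :: e1'), e2'; rewrite addnA; split=> //; constructor.
Qed.

Lemma crelE_consl n x t e e' : crelE S n ((x, t) :: e) e' ->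
  exists n1 n2 t' e1', [/\ n = n1 + n2, e' = (x, t') :: e1', crel S n1 t t' & crelE S n2 e e1'].
Proof. by move=> E; inversion E; subst; exists n0, m, t', e'0. Qed.

Lemma crel_letl n e s b : crel S n (Let e s) b ->
  n = 1 /\ S (Let e s) b \/
  exists n1 n2 e1 e' s', [/\ n = n1 + n2, b = Let e' s', crelE S n1 e e1,
    perm_eq e1 e' & crel S n2 s s'].
Proof. by move=> C; inversion C; subst; [left|right; exists n0, m, e1, e', s']. Qed.

Lemma crel_laml n x s b : crel S n (Lam x s) b ->
  n = 1 /\ S (Lam x s) b \/ exists2 s', b = Lam x s' & crel S n s s'.
Proof. by move=> C; inversion C; subst; [left|right; exists s']. Qed.

Lemma crel_varl n x b : crel S n (Var x) b -> n = 1 /\ S (Var x) b \/ n = 0 /\ b = Var x.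
Proof. by move=> C; inversion C; subst; [left|right]. Qed.

Lemma crel_appl n s t b : crel S n (App s t) b ->
  n = 1 /\ S (App s t) b \/
  exists n1 n2 s' t', [/\ n = n1 + n2, b = App s' t', crel S n1 s s' & crel S n2 t t'].
Proof. by move=> C; inversion C; subst; [left|right; exists n0, m, s', t']. Qed.

Lemma crel_probl n s t b : crel S n (Prob s t) b ->
  n = 1 /\ S (Prob s t) b \/
  exists n1 n2 s' t', [/\ n = n1 + n2, b = Prob s' t', crel S n1 s s' & crel S n2 t t'].
Proof. by move=> C; inversion C; subst; [left|right; exists n0, m, s', t']. Qed.

Lemma crelE_perm n e1 e2 e1' : crelE S n e1 e1' -> perm_eq e1 e2 ->
  exists2 e2', crelE S n e2 e2' & perm_eq e1' e2'.
Proof.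
move=> E; elim: E e2 => [|{}n m x t t' {}e1 {}e1' tt' _ IH] e2.
  by move/perm_size => /esym/size0nil ->; exists [::] => //; exact: crelE_nil.
move=> P; have: (x, t) \in e2 by rewrite -(perm_mem P) mem_head.
move=> xe2; case/splitPr: xe2 P => u v P.
have {}P: perm_eq e1 (u ++ v).
  by move: P; rewrite perm_sym -cat1s perm_catCA /= perm_cons perm_sym.
have [w /crelE_catl [n1 [n2 [u' [v' [-> -> uu' vv']]]]] P'] := IH _ P.
exists (u' ++ (x, t') :: v').
  by rewrite addnCA; apply: crelE_cat => //; constructor.
by rewrite perm_sym -cat1s perm_catCA /= perm_cons perm_sym.
Qed.

Lemma crel_ren f : (forall s t, S s t -> S (ren f s) (ren f t)) ->
  (forall n a b, crel S n a b -> crel S n (ren f a) (ren f b)) /\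
  (forall n e e', crelE S n e e' -> crelE S n (renE f e) (renE f e')).
Proof.
move=> Sf; apply: crel_crelE_ind => /=; try by constructor; auto.
by move=> n m e e1 e' s s' _ IHe P _ IHs; apply: crel_let IHe _ IHs; exact: perm_map.
Qed.

Hypothesis S_wf : forall s t, S s t -> wf s /\ wf t.

Lemma crel_wf n a b : crel S n a b -> wf a = wf b.
Proof.
suff [+ _] : (forall n a b, crel S n a b -> wf a = wf b) /\
  (forall n e e', crelE S n e e' -> all (fun b => wf b.2) e = all (fun b => wf b.2) e').
  exact.
apply: crel_crelE_ind => //=.
- by move=> s t /S_wf[-> ->].
- by move=> ? ? s s' t t' _ -> _ ->.
- by move=> ? ? s s' t t' _ -> _ ->.
- move=> k m e e1 e' s s' ee1 -> P _ ->; rewrite (crelE_dom ee1) (perm_uniq (perm_dom P)).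
  by rewrite (perm_all _ P).
- by move=> ? ? x t t' e e' _ -> _ ->.
Qed.

End CompatibleClosure.

(** With no pairs available, [crel] is syntactic identity up to the order of bindings at every
    [Let]. Results on [crel] thereby give results on representatives of one class. *)
Definition no_rel (_ _ : expr) := False.

Lemma crel_no_aeq n a b : crel no_rel n a b -> aeq a b.
Proof.
suff [+ _] : (forall n a b, crel no_rel n a b -> aeq a b) /\
  (forall n e e', crelE no_rel n e e' -> eqE e e') by exact.
apply: crel_crelE_ind => [s t []|x||||||].
- exact: aeq_refl.
- by move=> *; exact: aeq_lam.
- by move=> *; exact: aeq_app.
- by move=> *; exact: aeq_prob.
- move=> k m e e1 e' s s' _ E P _ A; apply: aeq_trans (aeq_let E A) _.
  exact: aeq_perm.
- exact: eqE_nil.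
- by move=> *; exact: eqE_cons.
Qed.

Lemma crel_no_pt p n a b : crel no_rel n a b -> crel no_rel n (pt p a) (pt p b).
Proof. by have [+ _] := @crel_ren no_rel (pv p) (fun _ _ => False_ind _); apply. Qed.

Definition bvE (e : env void) : seq var := flatten [seq bv b.2 | b <- e].
Definition fvE (e : env void) : seq var := flatten [seq fv b.2 | b <- e].

Lemma bv_let e s : bv (Let e s) = dom e ++ bvE e ++ bv s.
Proof. by []. Qed.

(** * Renaming binders apart on both sides of [crel] *)

Section Freshening.
Variable S : expr -> expr -> Prop.
Hypothesis S_pt : forall p s t, S s t -> S (pt p s) (pt p t).
Hypothesis S_fresh : forall s t, S s t -> forall X : seq var, exists s' t',
  [/\ S s' t', aeq s s', aeq t t',
      uniq (bv s') && uniq (bv t') & {in bv s' ++ bv t', forall y, y \notin X}].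

(** The binders of the multicontext carry the same names on both sides, so a single permutation
    freshens them on both; here closure of [S] under permutations enters. Names bound further inside
    are freshened beforehand and kept off the transposed names, hence are not moved. *)
Lemma crel_freshen n a b : crel S n a b -> wf a -> wf b -> forall X : seq var, exists a' b',
  [/\ crel S n a' b', aeq a a', aeq b b',
      uniq (bv a') && uniq (bv b') & {in bv a' ++ bv b', forall y, y \notin X}].
Proof.
suff [+ _] : (forall n a b, crel S n a b -> wf a -> wf b -> forall X : seq var, exists a' b',
  [/\ crel S n a' b', aeq a a', aeq b b',
      uniq (bv a') && uniq (bv b') & {in bv a' ++ bv b', forall y, y \notin X}]) /\
  (forall n e e', crelE S n e e' -> all (fun b => wf b.2) e -> all (fun b => wf b.2) e' ->
   forall X : seq var, exists e1 e1', [/\ crelE S n e1 e1', eqE e e1, eqE e' e1',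
      uniq (bvE e1) && uniq (bvE e1') & {in bvE e1 ++ bvE e1', forall y, y \notin X}]).
  exact.
have join (u u' v v' X : seq var) : uniq u && uniq u' -> uniq v && uniq v' ->
    {in u ++ u', forall y, y \notin X} ->
    {in v ++ v', forall y, y \notin X ++ u ++ u'} ->
    uniq (u ++ v) && uniq (u' ++ v') /\
    {in (u ++ v) ++ (u' ++ v'), forall y, y \notin X}.
  move=> /andP[uu uu'] /andP[uv uv'] Du Dv; split.
    rewrite !cat_uniq uu uu' uv uv' !andbT /=; apply/andP; split; apply/hasPn => y yv;
      have := Dv y; by rewrite !mem_cat yv ?orbT !negb_or => /(_ isT)/and3P[].
  move=> y yy; have [yv|yv] := boolP (y \in v ++ v').
    by have := Dv y yv; rewrite !mem_cat negb_or => /andP[].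
  apply: Du; move: yv yy; rewrite !mem_cat negb_or => /andP[/negbTE -> /negbTE ->].
  by rewrite !orbF.
apply: crel_crelE_ind => /=.
- by move=> s t st _ _ X; have [s' [t' [? ? ? ? ?]]] := S_fresh st X;
    exists s', t'; split=> //; exact: crel_hole.
- by move=> x _ _ X; exists (Var x), (Var x); split=> //; [exact: crel_var|exact: aeq_refl..].
- move=> k x s s' _ IH ws ws' X.
  have [[|y l] [] //= _ _ Y] := fresh_seq (x :: X ++ fv s ++ fv s') 1.
  have {}Y := Y y (mem_head _ _).
  have [s1 [s1' [C A A' U D]]] := IH ws ws' (x :: y :: X).
  have xy : x != y by move: Y; rewrite inE negb_or eq_sym => /andP[].
  have yX : y \notin X by move: Y; rewrite inE mem_cat !negb_or => /and3P[].
  have E u : {in bv u, forall z, z \notin x :: y :: X} -> bv (pt [:: (x, y)] u) = bv u.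
    move=> Du; rewrite bv_ren -[RHS]map_id; apply/eq_in_map => z /Du.
    by rewrite !inE !negb_or => /and3P[? ? _]; rewrite /= swapv_out.
  have L u u1 : aeq u u1 -> y \notin fv u -> aeq (Lam x u) (Lam y (pt [:: (x, y)] u1)).
    move=> uu1 yu; apply: aeq_trans (aeq_lam x uu1) _.
    by rewrite pt_cons pt_nil; apply: aeq_rename_lam; rewrite -(aeq_fv uu1).
  have [ys ys'] : y \notin fv s /\ y \notin fv s'.
    by move: Y; rewrite !inE !mem_cat !negb_or => /and4P[].
  have D1 : {in bv s1, forall z, z \notin x :: y :: X}.
    by move=> z zs; apply: D; rewrite mem_cat zs.
  have D1' : {in bv s1', forall z, z \notin x :: y :: X}.
    by move=> z zs; apply: D; rewrite mem_cat zs orbT.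
  exists (Lam y (pt [:: (x, y)] s1)), (Lam y (pt [:: (x, y)] s1')); split.
  + by apply: crel_lam; apply: (proj1 (crel_ren _)) C => *; exact: S_pt.
  + exact: L.
  + exact: L.
  + rewrite /= !E //; case/andP: U => -> ->; rewrite !andbT.
    by apply/andP; split; [apply/negP => /D1|apply/negP => /D1']; rewrite !inE eqxx orbT.
  + rewrite /= !E // => z; rewrite inE mem_cat inE.
    by case/or4P => [/eqP->|/D1|/eqP->|/D1'] //; rewrite !inE !negb_or => /and3P[].
- move=> k m s s' t t' _ IHs _ IHt /andP[ws wt] /andP[ws' wt'] X.
  have [s1 [s1' [C A A' U D]]] := IHs ws ws' X.
  have [t1 [t1' [Ct At At' Ut Dt]]] := IHt wt wt' (X ++ bv s1 ++ bv s1').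
  have [UU DD] := join _ _ _ _ _ U Ut D Dt.
  by exists (App s1 t1), (App s1' t1'); split=> //; [exact: crel_app|exact: aeq_app..].
- move=> k m s s' t t' _ IHs _ IHt /andP[ws wt] /andP[ws' wt'] X.
  have [s1 [s1' [C A A' U D]]] := IHs ws ws' X.
  have [t1 [t1' [Ct At At' Ut Dt]]] := IHt wt wt' (X ++ bv s1 ++ bv s1').
  have [UU DD] := join _ _ _ _ _ U Ut D Dt.
  by exists (Prob s1 t1), (Prob s1' t1'); split=> //; [exact: crel_prob|exact: aeq_prob..].
- move=> k m e e1 e' s s' ee1 IHe P _ IHs /and3P[ue we ws] /and3P[ue' we' ws'] X.
  have [ys [sz uys Y]] :=
    fresh_seq (X ++ dom e ++ fv (Let e s) ++ fv (Let e' s')) (size (dom e)).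
  have we1 : all (fun b => wf b.2) e1 by rewrite (perm_all _ P).
  have [e2 [e2' [Ce E E' Ue De]]] := IHe we we1 (X ++ dom e ++ ys).
  have [s2 [s2' [Cs A A' Us Ds]]] := IHs ws ws' ((X ++ dom e ++ ys) ++ bvE e2 ++ bvE e2').
  have [U D] := join _ _ _ _ _ Ue Us De Ds.
  have d2 : dom e2 = dom e by rewrite (eqE_dom E).
  have d2' : dom e2' = dom e by rewrite -(eqE_dom E') (crelE_dom ee1).
  pose z := zip (dom e) ys.
  have Aa : aeq (Let e s) (Let e2 s2) by exact: aeq_let.
  have Ab : aeq (Let e' s') (Let e2' s2').
    by apply: aeq_trans (aeq_let E' A'); apply: aeq_perm; rewrite perm_sym.
  have bvz u l : bv u = dom e ++ l -> uniq l -> {in l, forall w, w \notin X ++ dom e ++ ys} ->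
      uniq (bv (pt z u)) /\ {in bv (pt z u), forall w, w \notin X}.
    move=> Eu ul Dl; rewrite bv_ren Eu; split.
      rewrite map_inj_uniq // cat_uniq ue ul andbT /=; apply/hasPn => w /Dl.
      by rewrite !mem_cat !negb_or => /and3P[].
    move=> w; rewrite map_cat mem_cat => /orP[] /mapP[v vl ->].
      rewrite pv_zip_in //; last by move=> y /Y; rewrite !mem_cat !negb_or => /and3P[].
      have : nth 0 ys (index v (dom e)) \in ys by rewrite mem_nth // sz index_mem.
      by move/Y; rewrite mem_cat negb_or => /andP[].
    have := Dl _ vl; rewrite !mem_cat !negb_or => /and3P[vX ve vy].
    by rewrite pv_zip_out.
  have /andP[Ul Ul'] := U.
  have [Ua Da] : uniq (bv (pt z (Let e2 s2))) /\ {in bv (pt z (Let e2 s2)), forall w, w \notin X}.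
    apply: (bvz _ (bvE e2 ++ bv s2)) => //; first by rewrite bv_let d2.
    by move=> w ww; apply: D; rewrite mem_cat ww.
  have [Ub Db] : uniq (bv (pt z (Let e2' s2'))) /\ {in bv (pt z (Let e2' s2')), forall w, w \notin X}.
    apply: (bvz _ (bvE e2' ++ bv s2')) => //; first by rewrite bv_let d2'.
    by move=> w ww; apply: D; rewrite mem_cat ww orbT.
  exists (pt z (Let e2 s2)), (pt z (Let e2' s2')); split.
  + by apply: (proj1 (crel_ren _)) (crel_let Ce (perm_refl _) Cs) => *; exact: S_pt.
  + apply: (aeq_trans Aa); apply: aeq_let_freshen => //; first by rewrite d2.
    by move=> y /Y; rewrite d2 -(aeq_fv Aa) !mem_cat !negb_or => /and4P[].
  + apply: (aeq_trans Ab); apply: aeq_let_freshen => //; first by rewrite d2'.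
    by move=> y /Y; rewrite d2' -(aeq_fv Ab) !mem_cat !negb_or => /and4P[].
  + by rewrite Ua Ub.
  + by move=> y; rewrite mem_cat => /orP[/Da|/Db].
- by move=> _ _ X; exists [::], [::]; split=> //; [exact: crelE_nil|exact: eqE_nil..].
- move=> k m x t t' e e' _ IHt _ IHe /andP[wt we] /andP[wt' we'] X.
  have [t1 [t1' [C A A' U D]]] := IHt wt wt' X.
  have [e1 [e1' [Ce E E' Ue De]]] := IHe we we' (X ++ bv t1 ++ bv t1').
  have [UU DD] := join _ _ _ _ _ U Ue D De.
  by exists ((x, t1) :: e1), ((x, t1') :: e1'); split=> //; [exact: crelE_cons|exact: eqE_cons..].
Qed.

End Freshening.

Lemma aeq_fresh s (X : seq var) : wf s -> exists s',
  [/\ aeq s s', uniq (bv s') & {in bv s', forall y, y \notin X}].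
Proof.
move=> ws; have [//|s1 [s2 [_ A _ /andP[U _] D]]] :=
  @crel_freshen no_rel (fun _ _ _ => id) _ 0 s s (crel_refl _ _) ws ws X.
by exists s1; split=> // y ys; apply: D; rewrite mem_cat ys.
Qed.

(** * Aligning the bound names of alpha-equivalent terms *)

Definition mapE (g : expr -> expr) (e : env void) := [seq (b.1, g b.2) | b <- e].
Definition fixes (p : prm) (N : seq var) := {in N, forall z, pv p z = z}.
(** Confining a permutation to bound names lets those built for different subterms be composed: for
    separated terms they move disjoint sets of names. *)
Definition supported (p : prm) (B B' : seq var) :=
  forall z, z \notin B -> z \notin B' -> pv p z = z.
Definition aligned (a a' : expr) (p : prm) := exists n, crel no_rel n (pt p a) a'.
Definition alignedE (e e' : env void) (p : prm) :=
  exists n, crelE no_rel n (mapE (pt p) e) e'.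

Lemma fixes_pt p s : fixes p (bv s ++ fv s) -> pt p s = s.
Proof. by move=> F; apply: ren_id_in => z zs; apply: F; rewrite mem_cat zs ?orbT. Qed.

Lemma fixes_ptE p e : fixes p (bvE e ++ fvE e) -> mapE (pt p) e = e.
Proof.
move=> F; rewrite /mapE -[RHS]map_id; apply/eq_in_map => -[x t] xt /=; congr pair.
apply: fixes_pt => z; rewrite mem_cat => zt; apply: F; rewrite mem_cat; apply/orP.
by case/orP: zt => zt; [left; apply/mem_bv_env|right; apply/mem_fv_env]; exists x, t.
Qed.

Lemma mapE_comp p q e : mapE (pt p) (mapE (pt q) e) = mapE (pt (p ++ q)) e.
Proof. by rewrite /mapE -map_comp; apply: eq_map => b /=; rewrite pt_cat. Qed.

Lemma crelE_no_mapE p n e e' : crelE no_rel n e e' ->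
  crelE no_rel n (mapE (pt p) e) (mapE (pt p) e').
Proof. by elim=> [|k m x t t' {}e {}e' C _ IH] /=; constructor=> //; exact: crel_no_pt. Qed.

Lemma aligned_catr a a' p q : aligned a a' p -> fixes q (bv a ++ fv a) -> aligned a a' (p ++ q).
Proof. by move=> [n C] F; exists n; rewrite pt_cat (fixes_pt F). Qed.

Lemma aligned_catl a a' p q : aligned a a' p -> fixes q (bv a' ++ fv a') -> aligned a a' (q ++ p).
Proof. by move=> [n C] F; exists n; rewrite pt_cat -(fixes_pt F); exact: crel_no_pt. Qed.

Lemma alignedE_catr e e' p q : alignedE e e' p -> fixes q (bvE e ++ fvE e) ->
  alignedE e e' (p ++ q).
Proof. by move=> [n C] F; exists n; rewrite -mapE_comp (fixes_ptE F). Qed.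

Lemma alignedE_catl e e' p q : alignedE e e' p -> fixes q (bvE e' ++ fvE e') ->
  alignedE e e' (q ++ p).
Proof. by move=> [n C] F; exists n; rewrite -mapE_comp -(fixes_ptE F); exact: crelE_no_mapE. Qed.

Definition separated (B B' V : seq var) :=
  [/\ uniq B, uniq B', {in B, forall x, x \notin B'} &
      {in V, forall x, x \notin B /\ x \notin B'}].

(** The last two parts are what composition needs: a permutation built for one half fixes every
    name, bound or free, of the other half on both sides. *)
Lemma separated_cat B1 B1' V1 B2 B2' V2 :
  separated (B1 ++ B2) (B1' ++ B2') (V1 ++ V2) ->
  [/\ separated B1 B1' V1, separated B2 B2' V2,
      forall p, supported p B1 B1' -> fixes p (B2 ++ V2) /\ fixes p (B2' ++ V2) &
      forall p, supported p B2 B2' -> fixes p (B1 ++ V1) /\ fixes p (B1' ++ V1)].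
Proof.
case; rewrite !cat_uniq => /and3P[u1 /hasPn d u2] /and3P[u1' /hasPn d' u2'] D F.
have D1 x : x \in B1 -> x \notin B1' /\ x \notin B2'.
  by move=> xB; have := D x; rewrite !mem_cat xB negb_or => /(_ isT)/andP[].
have D2 x : x \in B2 -> x \notin B1' /\ x \notin B2'.
  by move=> xB; have := D x; rewrite !mem_cat xB orbT negb_or => /(_ isT)/andP[].
have F' x : x \in V1 ++ V2 -> [/\ x \notin B1, x \notin B2, x \notin B1' & x \notin B2'].
  by move=> /F; rewrite !mem_cat !negb_or => -[/andP[? ?] /andP[? ?]].
have F1 x : x \in V1 -> [/\ x \notin B1, x \notin B2, x \notin B1' & x \notin B2'].
  by move=> xV; apply: F'; rewrite mem_cat xV.
have F2 x : x \in V2 -> [/\ x \notin B1, x \notin B2, x \notin B1' & x \notin B2'].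
  by move=> xV; apply: F'; rewrite mem_cat xV orbT.
split.
- by split=> // x; [case/D1|case/F1].
- by split=> // x; [case/D2|case/F2].
- move=> p sp; split=> x; rewrite mem_cat => /orP[xx|/F2[? ? ? ?]]; apply: sp => //.
  + exact: d.
  + by have [] := D2 x xx.
  + by apply/negP => /D1[_]; rewrite xx.
  + exact: d'.
- move=> p sp; split=> x; rewrite mem_cat => /orP[xx|/F1[? ? ? ?]]; apply: sp => //.
  + by apply/negP => /d; rewrite /= xx.
  + by have [] := D1 x xx.
  + by apply/negP => /D2[]; rewrite xx.
  + by apply/negP => /d'; rewrite /= xx.
Qed.

Definition alignable (a a' : expr) := separated (bv a) (bv a') (fv a) -> aeq a a' ->
  exists2 p, supported p (bv a) (bv a') & aligned a a' p.

Lemma supported_cat p q B1 B1' B2 B2' : supported p B1 B1' -> supported q B2 B2' ->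
  supported (p ++ q) (B1 ++ B2) (B1' ++ B2').
Proof.
move=> sp sq z; rewrite !mem_cat !negb_or => /andP[? ?] /andP[? ?].
by rewrite pv_cat sq // sp.
Qed.

Lemma eq_fixes p N N' : N =i N' -> fixes p N -> fixes p N'.
Proof. by move=> E F z; rewrite -E; exact: F. Qed.

Lemma alignable_pair a a' b b' : alignable a a' -> alignable b b' ->
  separated (bv a ++ bv b) (bv a' ++ bv b') (fv a ++ fv b) -> aeq a a' -> aeq b b' ->
  exists2 p, supported p (bv a ++ bv b) (bv a' ++ bv b') & aligned a a' p /\ aligned b b' p.
Proof.
move=> Ga Gb /separated_cat[sa sb fb fa] A B.
have [p sp ap] := Ga sa A; have [q sq bq] := Gb sb B.
exists (p ++ q); first exact: supported_cat.
split; first by apply: aligned_catr ap _; have [] := fa _ sq.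
apply: aligned_catl bq _; have [_] := fb _ sp; apply: eq_fixes => z.
by rewrite !mem_cat (aeq_fv B).
Qed.

Lemma eqE_fvE e e' : eqE e e' -> fvE e =i fvE e'.
Proof.
by elim=> //= x t t' {}e {}e' A _ IH z; rewrite /fvE /= !mem_cat (aeq_fv A) IH.
Qed.

Lemma alignableE e e' : eqE e e' ->
  (forall x t, (x, t) \in e -> forall t', alignable t t') ->
  separated (bvE e) (bvE e') (fvE e) ->
  exists2 p, supported p (bvE e) (bvE e') & alignedE e e' p.
Proof.
elim=> [|x t t' {}e {}e' A E IH] G.
  by move=> _; exists [::] => //; exists 0; exact: crelE_nil.
rewrite /bvE /fvE /= -!/(bvE _) -!/(fvE _) => /separated_cat[st se fe ft].
have [p sp [n C]] := G x t (mem_head _ _) t' st A.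
have [y u yu|q sq eq] := IH _ se; first by apply: (G y u); rewrite inE yu orbT.
exists (p ++ q); first exact: supported_cat.
have [k Ck] : alignedE e e' (p ++ q).
  apply: alignedE_catl eq _; have [_] := fe _ sp; apply: eq_fixes => z.
  by rewrite !mem_cat (eqE_fvE E).
have [m Cm] : aligned t t' (p ++ q).
  by apply: aligned_catr; [exists n; exact: C|have [] := ft _ sq].
by exists (m + k); constructor.
Qed.

Lemma mem_fvE_let e s x : x \in fvE e ++ fv s -> x \notin dom e -> x \in fv (Let e s).
Proof. by move=> xs xe; rewrite /= mem_filter xe. Qed.

(** The induction covers all permuted copies of [a], because the binder cases pass to [pt z] of the
    body, which is not a subterm; the extra permutation is absorbed in [q]. *)
Lemma aeq_alignable a q a' : alignable (pt q a) a'.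
Proof.
elim/expr_ind: a q a' => [x|x s IH|s t IHs IHt|s t IHs IHt|e s IHe IHs] q a'.
- move=> _ /aeq_hrel; case: a' => // y /= <-; exists [::] => //.
  by exists 0; rewrite pt_nil; exact: crel_var.
- case=> u u' D F A; have := aeq_hrel A; case: a' u' D F A => // y s' u' D F A.
  move=> /= [p [P xy B]]; set x0 := pv q x in u D F A P xy *; set s0 := ren (pv q) s in u D F A P B *.
  have yx : y != x0.
    by apply/eqP => yx; have := D x0; rewrite yx !mem_head => /(_ isT).
  have [xs us] : x0 \notin bv s0 /\ uniq (bv s0) by apply/andP.
  have [ys us'] : y \notin bv s' /\ uniq (bv s') by apply/andP.
  have ys0 : y \notin bv s0.
    by apply/negP => ys0; have := D y; rewrite /= !inE eqxx ys0 orbT => /(_ isT).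
  have xs' : x0 \notin bv s'.
    by have := D x0; rewrite /= !inE eqxx negb_or => /(_ isT)/andP[].
  have yf : y \notin fv s0.
    apply/negP => yf; have := F y; rewrite /= mem_filter yx yf !inE eqxx => /(_ isT).
    by case=> _ /negP.
  (* The [p] given by [hrel] may move names bound inside [s0]. The bare swap of the two binders
     agrees with it on the free names of [s0], which suffices by [aeq_ren_agree], and leaves the
     bound names in place. *)
  pose z := [:: (x0, y)].
  have bvz : bv (pt z s0) = bv s0.
    rewrite bv_ren -[RHS]map_id; apply/eq_in_map => w ws; rewrite /= swapv_out //.
      by apply: contraNneq xs => <-.
    by apply: contraNneq ys0 => <-.
  have Az : aeq (pt z s0) s'.
    apply: aeq_trans B; apply: aeq_ren_agree => // w ws /=.
    have [->|wx] := eqVneq w x0; first by rewrite swapv_l.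
    rewrite swapv_out // ?P ?mem_filter ?wx //.
    by apply: contraNneq yf => <-.
  have := IH (z ++ q) s'; rewrite pt_cat -/s0.
  case=> //.
    rewrite bvz; split=> //.
      by move=> w ws; have := D w; rewrite /= !inE ws orbT negb_or => /(_ isT)/andP[].
    move=> w; rewrite fv_ren // => /mapP[v vs ->] /=.
    have [->|vx] := eqVneq v x0; first by rewrite swapv_l.
    have vy : v != y by apply: contraNneq yf => <-.
    rewrite swapv_out //; have := F v; rewrite /= mem_filter vx vs !inE !negb_or => /(_ isT).
    by case=> /andP[? ?] /andP[? ?].
  move=> r; rewrite bvz => sr [n C]; exists (r ++ z).
    move=> w; rewrite /= !inE !negb_or => /andP[wx ws] /andP[wy ws'].
    by rewrite pv_cat /= swapv_out // sr.
  exists n; rewrite pt_cat.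
  have -> : pt r (pt z (pt q (Lam x s))) = Lam y (pt r (pt z s0)).
    by rewrite /pt /= swapv_l sr.
  exact: crel_lam.
- move=> sep A; have := aeq_hrel A; case: a' A sep => // s' t' A sep [As At].
  have [p sp [[n Cn] [m Cm]]] := alignable_pair (IHs q s') (IHt q t') sep As At.
  by exists p => //; exists (n + m); exact: crel_app.
- move=> sep A; have := aeq_hrel A; case: a' A sep => // s' t' A sep [As At].
  have [p sp [[n Cn] [m Cm]]] := alignable_pair (IHs q s') (IHt q t') sep As At.
  by exists p => //; exists (n + m); exact: crel_prob.
have -> : pt q (Let e s) = Let (ptE q e) (pt q s) by [].
move=> sep A; have := aeq_hrel A; case: a' A sep => // e' s' A sep [p [e1 [P E Pe As]]].
set e0 := ptE q e in A sep P E *; set s0 := pt q s in A sep P As *.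
have d : dom e1 = map (pv p) (dom e0) by rewrite -(eqE_dom E) dom_ptE.
(* The right-hand side is first taken with [e1], which lists the bindings of [e'] in the order of
   [e0]. The remaining reordering is absorbed by [crel_let]. *)
have Pbv : perm_eq (bv (Let e1 s')) (bv (Let e' s')).
  rewrite !bv_let perm_cat ?perm_dom // perm_cat //.
  by apply: perm_flatten; exact: perm_map.
have {}sep : separated (bv (Let e0 s0)) (bv (Let e1 s')) (fv (Let e0 s0)).
  case: sep => ? ? D F; split=> //; first by rewrite (perm_uniq Pbv).
    by move=> w /D; rewrite (perm_mem Pbv).
  by move=> w /F[? ?]; rewrite (perm_mem Pbv).
suff [r sr [n C]] : exists2 r, supported r (bv (Let e0 s0)) (bv (Let e1 s'))
    & aligned (Let e0 s0) (Let e1 s') r.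
  exists r; first by move=> w ww ww'; apply: sr => //; rewrite (perm_mem Pbv).
  exists n; have [[_ []]|[n1 [n2 [e2 [e3 [s2 [-> [<- <-] Ce P2 Cs]]]]]]] := crel_letl C.
  by apply: (crel_let Ce _ Cs); exact: perm_trans P2 Pe.
move: sep; rewrite !bv_let; set F := fv _ => -[].
rewrite cat_uniq => /and3P[ud /hasPn dis ui].
rewrite cat_uniq => /and3P[ud' /hasPn dis' ui'] D V.
set I := bvE e0 ++ bv s0 in dis ui D V *; set I' := bvE e1 ++ bv s' in dis' ui' D V *.
have Dd w : w \in dom e0 -> [/\ w \notin I, w \notin dom e1 & w \notin I'].
  move=> we; have := D w; rewrite mem_cat we => /(_ isT); rewrite mem_cat negb_or => /andP[-> ->].
  by split=> //; apply/negP => /dis; rewrite /= we.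
have DI w : w \in I -> [/\ w \notin dom e0, w \notin dom e1 & w \notin I'].
  move=> we; have := D w; rewrite mem_cat we orbT => /(_ isT); rewrite mem_cat negb_or => /andP[-> ->].
  by split=> //; exact: dis.
have Dd' w : w \in dom e1 -> [/\ w \notin dom e0, w \notin I & w \notin I'].
  move=> we; split; try by apply/negP => /Dd[]; rewrite we.
    by apply/negP => /DI[]; rewrite we.
  by apply/negP => /dis'; rewrite /= we.
have DF w : w \in F -> [/\ w \notin dom e0, w \notin I, w \notin dom e1 & w \notin I'].
  by move=> /V; rewrite !mem_cat !negb_or => -[/andP[? ?] /andP[? ?]].
(* As for abstractions, [p] is traded for the transpositions of corresponding binders only. *)
pose z := zip (dom e0) (dom e1).
have sz : size (dom e0) = size (dom e1) by rewrite d size_map.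
have zin w : w \in dom e0 -> pv z w = pv p w.
  move=> we; rewrite pv_zip_in //; last by move=> y /Dd'[].
  by rewrite d (nth_map 0) ?index_mem // nth_index.
have zout w : w \notin dom e0 -> w \notin dom e1 -> pv z w = w by exact: pv_zip_out.
have zp w : w \in fvE e0 ++ fv s0 -> pv z w = pv p w.
  move=> ww; have [we|we] := boolP (w \in dom e0); first exact: zin.
  have wF : w \in F by exact: mem_fvE_let.
  by rewrite P // zout //; have [] := DF w wF.
have bvz t : {subset bv t <= I} -> bv (pt z t) = bv t.
  move=> tI; rewrite bv_ren -[RHS]map_id; apply/eq_in_map => w /tI/DI[? ? _].
  exact: zout.
pose e2 := ptE z e0.
have dz : dom e2 = dom e1.
  by rewrite dom_ptE d; apply/eq_in_map => w; exact: zin.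
have bvE2 : bvE e2 = bvE e0.
  rewrite /bvE /e2 /ptE /renE -map_comp; congr flatten; apply/eq_in_map => -[w t] wt /=.
  apply: bvz => y yt; rewrite mem_cat; apply/orP; left.
  by apply/mem_bv_env; exists w, t.
have bvs : bv (pt z s0) = bv s0 by apply: bvz => y yt; rewrite mem_cat yt orbT.
have As2 : aeq (pt z s0) s'.
  by apply: aeq_trans As; apply: aeq_ren_agree => // w ws; apply: zp; rewrite mem_cat ws orbT.
have E2 : eqE e2 e1.
  apply: eqE_trans E; rewrite /e2 /ptE /renE; apply: eqE_map => y t yt; split.
    by apply: zin; apply/domP; exists t.
  apply: aeq_ren_agree => // w wt; apply: zp; rewrite mem_cat; apply/orP; left.
  by apply/mem_fv_env; exists y, t.
have fvz w : w \in fvE e2 ++ fv (pt z s0) -> w \notin I /\ w \notin I'.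
  have -> : fvE e2 ++ fv (pt z s0) = map (pv z) (fvE e0 ++ fv s0).
    rewrite map_cat fv_ren //; congr cat.
    rewrite /fvE /e2 /ptE /renE map_flatten -!map_comp; congr flatten.
    by apply/eq_map => -[y t] /=; rewrite fv_ren.
  case/mapP => v vv ->; have [ve|ve] := boolP (v \in dom e0).
    rewrite zin //; have : pv p v \in dom e1 by rewrite d map_f.
    by case/Dd'.
  have /DF[? ? ? ?] : v \in F by exact: mem_fvE_let.
  by rewrite zout.
have /separated_cat[se ss fs fe] : separated (bvE e2 ++ bv (pt z s0)) (bvE e1 ++ bv s')
    (fvE e2 ++ fv (pt z s0)).
  by rewrite bvE2 bvs; split=> // w /DI[].
have [y t|pe spe ape] := alignableE E2 _ se.
  case/mapP => -[y' t'] + [_ ->] => /mapP[[y'' t''] yt'' [_ ->]] t1.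
  have := IHe _ _ yt'' (z ++ q) t1; by rewrite pt_cat.
have [ps sps aps] : exists2 p, supported p (bv (pt z s0)) (bv s') & aligned (pt z s0) s' p.
  by have := IHs (z ++ q) s'; rewrite pt_cat; apply.
have [k Ck] : alignedE e2 e1 (pe ++ ps) by apply: alignedE_catr ape _; have [] := fe _ sps.
have [m Cm] : aligned (pt z s0) s' (pe ++ ps).
  apply: aligned_catl aps _; have [_] := fs _ spe; apply: eq_fixes => w.
  by rewrite !mem_cat (aeq_fv As2).
have spr := supported_cat spe sps; rewrite bvE2 bvs -/I -/I' in spr.
exists ((pe ++ ps) ++ z).
  move=> w; rewrite !mem_cat -![(_ \in bvE _) || _]mem_cat -/I -/I' !negb_or.
  by move=> /andP[? ?] /andP[? ?]; rewrite pv_cat zout // spr.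
exists (k + m); rewrite pt_cat.
have -> : pt (pe ++ ps) (pt z (Let e0 s0)) = Let (mapE (pt (pe ++ ps)) e2) (pt (pe ++ ps) (pt z s0)).
  have -> : pt z (Let e0 s0) = Let e2 (pt z s0) by [].
  rewrite [LHS]/pt ren_let; congr Let; apply/eq_in_map => -[w t] wt /=; congr pair.
  have : w \in dom e1 by rewrite -dz; apply/domP; exists t.
  by case/Dd' => ? ? ?; exact: spr.
exact: crel_let Ck (perm_refl _) Cm.
Qed.

Lemma aeq_align a a' : dvc a -> dvc a' -> {in bv a, forall x, x \notin bv a'} -> aeq a a' ->
  exists p n, {in fv a, forall x, pv p x = x} /\ crel no_rel n (pt p a) a'.
Proof.
move=> /andP[u /allP F] /andP[u' /allP F'] D A.
have := @aeq_alignable a [::] a'; rewrite pt_nil; case=> //.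
  split=> // x xa; split; [apply/negP => /F|apply/negP => /F']; rewrite ?xa //.
  by rewrite -(aeq_fv A) xa.
move=> p sp [n C]; exists p, n; split=> // x xa.
apply: sp; [apply/negP => /F|apply/negP => /F']; rewrite ?xa //.
by rewrite -(aeq_fv A) xa.
Qed.

(** * Reduction *)

(** The rules of [red] that apply in any reduction context, with application contexts unfolded into
    the congruence [lstep_app]. This permits induction along the spine; what is left of a reduction
    context is one of three surroundings, the first three constructors of [red2]. *)
Inductive lstep : rule -> expr -> expr -> Prop :=
| lstep_beta x s t : lstep Lbeta (App (Lam x s) t) (Let [:: (x, t)] s)
| lstep_probl s t : lstep Probl (Prob s t) s
| lstep_probr s t : lstep Probr (Prob s t) t
| lstep_lapp e s t : lstep Lapp (App (Let e s) t) (Let e (App s t))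
| lstep_app r s s' t : lstep r s s' -> lstep r (App s t) (App s' t).

Inductive red2 : rule -> expr -> expr -> Prop :=
| red2_top r s t : lstep r s t -> red2 r s t
| red2_body r e s t : lstep r s t -> red2 r (Let e s) (Let e t)
| red2_bind r e c y s t A : lstep r s t ->
    red2 r (Let (e ++ links c y ++ [:: (y, s)]) (fillA A (Var (first c y))))
           (Let (e ++ links c y ++ [:: (y, t)]) (fillA A (Var (first c y))))
| red2_llet_in e1 e2 s : red2 LletIn (Let e1 (Let e2 s)) (Let (e1 ++ e2) s)
| red2_llet_e c x e1 s e2 A :
    red2 LletE
      (Let (links c x ++ (x, Let e1 s) :: e2) (fillA A (Var (first c x))))
      (Let (links c x ++ (x, s) :: e1 ++ e2) (fillA A (Var (first c x))))
| red2_cp_in xs x y s e A :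
    red2 CpIn
      (Let (links (vchain xs) x ++ (x, Lam y s) :: e)
           (fillA A (Var (first (vchain xs) x))))
      (Let (links (vchain xs) x ++ (x, Lam y s) :: e)
           (fillA A (Lam y s)))
| red2_cp_e c x B ys y z s e A :
    B <> AHole ->
    red2 CpE
      (Let (links c x ++ (x, fillA B (Var (first (vchain ys) y))) ::
            links (vchain ys) y ++ (y, Lam z s) :: e)
           (fillA A (Var (first c x))))
      (Let (links c x ++ (x, fillA B (Lam z s)) ::
            links (vchain ys) y ++ (y, Lam z s) :: e)
           (fillA A (Var (first c x)))).

Lemma lstep_fillA r A s t : lstep r s t -> lstep r (fillA A s) (fillA A t).
Proof. by move=> st; elim: A => //= A IH u; exact: lstep_app. Qed.

Lemma red2_fillR r R s t : lstep r s t -> red2 r (fillR R s) (fillR R t).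
Proof.
case: R => [A|e A|e c y B A] /= st.
- by apply: red2_top; exact: lstep_fillA.
- by apply: red2_body; exact: lstep_fillA.
- by apply: red2_bind; exact: lstep_fillA.
Qed.

Lemma red_red2 r s t : red r s t -> red2 r s t.
Proof.
by case=> *; try (by constructor); apply: red2_fillR; constructor.
Qed.

Fixpoint compA (A B : actx) : actx :=
  if A is AApp A s then AApp (compA A B) s else B.

Lemma fillA_compA A B s : fillA (compA A B) s = fillA A (fillA B s).
Proof. by elim: A => //= A ->. Qed.

(** Extends the innermost application context by an argument, so that the congruence [lstep_app] is
    matched by a change of reduction context. *)
Definition pushR (R : rctx) (u : expr) : rctx :=
  match R with
  | RApp A => RApp (compA A (AApp AHole u))
  | RLet e A => RLet e (compA A (AApp AHole u))
  | RChain e c y B A => RChain e c y (compA B (AApp AHole u)) A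
  end.

Lemma fillR_pushR R u s : fillR (pushR R u) s = fillR R (App s u).
Proof. by case: R => [A|e A|e c y B A] /=; rewrite fillA_compA. Qed.

Lemma red_lstep r R s t : lstep r s t -> red r (fillR R s) (fillR R t).
Proof.
move=> st; elim: st R => *; try by constructor.
by rewrite -!fillR_pushR.
Qed.

Lemma red2_red r s t : red2 r s t -> red r s t.
Proof.
case=> *; try by constructor.
- exact: (@red_lstep _ (RApp AHole)).
- exact: (@red_lstep _ (RLet _ AHole)).
- exact: (@red_lstep _ (RChain _ _ _ AHole _)).
Qed.

Lemma links_cat c1 c2 y : links (c1 ++ c2) y = links c1 (first c2 y) ++ links c2 y.
Proof. by elim: c1 => //= -[x A] c1 ->; congr ((_, fillA _ (Var _)) :: _); case: c1 => [|[]]. Qed.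

Lemma first_cat c1 c2 y : first (c1 ++ c2) y = first c1 (first c2 y).
Proof. by case: c1 => [|[]]. Qed.

Lemma dom_links c y : dom (links c y) = dom c.
Proof. by elim: c => //= -[x A] c; rewrite /dom /= => ->. Qed.

(** * Reduction steps under renaming *)

Fixpoint renA f (A : actx) : actx :=
  if A is AApp A s then AApp (renA f A) (ren f s) else AHole.
Definition renC f (c : seq (var * actx)) := [seq (f b.1, renA f b.2) | b <- c].

Lemma ren_fillA f A s : ren f (fillA A s) = fillA (renA f A) (ren f s).
Proof. by elim: A => //= A ->. Qed.

Lemma first_renC f c y : first (renC f c) (f y) = f (first c y).
Proof. by case: c => [|[]]. Qed.

Lemma renE_links f c y : renE f (links c y) = links (renC f c) (f y).
Proof. by elim: c => //= -[x A] c IH /=; rewrite IH ren_fillA first_renC. Qed.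

Lemma renC_vchain f xs : renC f (vchain xs) = vchain (map f xs).
Proof. by rewrite /renC /vchain -!map_comp. Qed.

Lemma renE_cat f e e' : renE f (e ++ e') = renE f e ++ renE f e'.
Proof. exact: map_cat. Qed.

Lemma renE_cons f x t e : renE f ((x, t) :: e) = (f x, ren f t) :: renE f e.
Proof. by []. Qed.

Lemma lstep_ren f r s t : lstep r s t -> lstep r (ren f s) (ren f t).
Proof. by elim=> *; constructor. Qed.

Lemma red2_ren f r s t : red2 r s t -> red2 r (ren f s) (ren f t).
Proof.
have fv xs y : f (first (vchain xs) y) = first (vchain (map f xs)) (f y) by case: xs.
have lv xs y : renE f (links (vchain xs) y) = links (vchain (map f xs)) (f y).
  by rewrite renE_links renC_vchain.
case=> {r s t}.
- by move=> r s t st; apply: red2_top; exact: lstep_ren.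
- by move=> r e s t st; apply: red2_body; exact: lstep_ren.
- move=> r e c y s t A st; rewrite !ren_let !renE_cat renE_links !ren_fillA /= -!first_renC.
  by apply: red2_bind; exact: lstep_ren.
- by move=> e1 e2 s; rewrite !ren_let renE_cat; constructor.
- move=> c x e1 s e2 A; rewrite !ren_let !renE_cat !renE_cons !renE_cat renE_links.
  by rewrite !ren_fillA /= -!first_renC; constructor.
- move=> xs x y s e A; rewrite !ren_let !renE_cat !renE_cons lv !ren_fillA /= fv.
  by constructor.
- move=> c x B ys y z s e A BN; rewrite !ren_let !(renE_cat, renE_cons) renE_links lv.
  rewrite !ren_fillA /= fv -!first_renC; apply: red2_cp_e.
  by case: B BN.
Qed.

(** * Free names and well-formedness along a step *)

Fixpoint fvA (A : actx) : seq var :=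
  if A is AApp A s then fvA A ++ fv s else [::].

Lemma mem_fv_fillA A s x : (x \in fv (fillA A s)) = (x \in fv s) || (x \in fvA A).
Proof. by elim: A => /= [|A IH u]; rewrite ?orbF // !mem_cat IH orbA. Qed.

Lemma fv_let_sub e s e' s' : {subset dom e <= dom e'} ->
  (forall x, x \in fvE e' ++ fv s' -> (x \in dom e') || (x \in fvE e ++ fv s)) ->
  {subset fv (Let e' s') <= fv (Let e s)}.
Proof.
move=> D F x; rewrite /= !mem_filter => /andP[xd /F]; rewrite (negbTE xd) /= => ->.
by rewrite andbT; apply: contra xd => /D.
Qed.

Lemma fvE_cat e e' : fvE (e ++ e') = fvE e ++ fvE e'.
Proof. by rewrite /fvE map_cat flatten_cat. Qed.

Lemma fvE_cons x t e : fvE ((x, t) :: e) = fv t ++ fvE e.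
Proof. by []. Qed.

Lemma lstep_fv r s t : lstep r s t -> {subset fv t <= fv s}.
Proof.
elim=> {r s t}.
- move=> x s t y; rewrite /= !mem_filter !mem_cat mem_filter !inE orbF => /andP[-> /orP[]->] //.
  by rewrite orbT.
- by move=> s t x; rewrite /= mem_cat => ->.
- by move=> s t x; rewrite /= mem_cat => ->; rewrite orbT.
- move=> e s t x; rewrite /= !mem_cat !mem_filter !mem_cat => /andP[-> /or3P[]->] //;
    by rewrite ?orbT.
- by move=> r s s' t _ IH x; rewrite /= !mem_cat => /orP[/IH|] ->; rewrite ?orbT.
Qed.

Lemma red2_fv r s t : red2 r s t -> {subset fv t <= fv s}.
Proof.
case=> {r s t}.
- by move=> r s t; exact: lstep_fv.
- move=> r e s t /lstep_fv F; apply: fv_let_sub => // x; rewrite !mem_cat.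
  by case/orP => [->|/F ->]; rewrite ?orbT.
- move=> r e c y s t A /lstep_fv F; apply: fv_let_sub.
    by rewrite !dom_cat /dom /=.
  move=> x; rewrite !fvE_cat !fvE_cons !mem_cat -!orbA.
  by repeat case/orP; try move/F; move=> ->; rewrite ?orbT.
- move=> e1 e2 s; apply: fv_let_sub; first by move=> x; rewrite dom_cat mem_cat => ->.
  move=> x; rewrite !fvE_cat dom_cat /= !(mem_cat, mem_filter) -!orbA.
  by case: (x \in dom e2); rewrite ?orbT //= -/(fvE e2) => ->; rewrite orbT.
- move=> c x e1 s e2 A; apply: fv_let_sub.
    by move=> z; rewrite !dom_cat /dom /= !(mem_cat, inE, map_cat) => /or3P[]->; rewrite ?orbT.
  move=> z; rewrite !fvE_cat !fvE_cons !fvE_cat !dom_cat [dom (_ :: _)]/= !dom_cat /=.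
  rewrite -/(fvE e1) !(mem_cat, inE, mem_filter) -!orbA.
  by case: (z \in dom e1); rewrite ?orbT //=; repeat case/orP; move=> ->; rewrite ?orbT.
- move=> xs x y s e A; apply: fv_let_sub => // z.
  rewrite !fvE_cat !fvE_cons !mem_cat !mem_fv_fillA -!orbA.
  by repeat case/orP; move=> ->; rewrite ?orbT.
- move=> c x B ys y z s e A _; apply: fv_let_sub.
    by rewrite !dom_cat /dom /=.
  move=> w; rewrite !fvE_cat !fvE_cons !fvE_cat !fvE_cons !mem_cat !mem_fv_fillA -!orbA.
  by repeat case/orP; move=> ->; rewrite ?orbT.
Qed.

Lemma lstep_wf r s t : lstep r s t -> wf s -> wf t.
Proof.
elim=> {r s t} /=.
- by move=> x s t /andP[-> ->].
- by move=> s t /andP[].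
- by move=> s t /andP[].
- by move=> e s t /andP[/and3P[-> -> ->] ->].
- by move=> r s s' t _ IH /andP[/IH -> ->].
Qed.


Lemma wf_fillA A s : wf (fillA A s) = wf_actx A && wf s.
Proof. by elim: A => //= A -> u; rewrite andbAC. Qed.

Lemma uniq_bv_wf (s : expr) : uniq (bv s) -> wf s.
Proof.
elim/expr_ind: s => //=.
- by move=> x s IH /andP[_ /IH].
- by move=> s t IHs IHt; rewrite cat_uniq => /and3P[/IHs -> _ /IHt].
- by move=> s t IHs IHt; rewrite cat_uniq => /and3P[/IHs -> _ /IHt].
- move=> e s IHe IHs; rewrite cat_uniq => /and3P[-> _]; rewrite cat_uniq => /and3P[ue _ /IHs ->].
  rewrite andbT /=; elim: e IHe ue => //= -[x t] e IH IHe; rewrite cat_uniq => /and3P[ut _ ue].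
  rewrite (IHe x t) ?mem_head //= IH // => y u yu; apply: (IHe y).
  by rewrite inE yu orbT.
Qed.

Lemma dvc_wf s : dvc s -> wf s.
Proof. by case/andP => /uniq_bv_wf. Qed.

(** Distinct binders keep the domain duplicate-free when [LletIn] and [LletE] merge two
    environments. *)
Lemma red2_wf r s t : red2 r s t -> uniq (bv s) -> wf t.
Proof.
move=> st us; have := uniq_bv_wf us; case: st us => {r s t}.
- by move=> r s t st _; exact: lstep_wf st.
- by move=> r e s t st _ /= /and3P[-> -> /(lstep_wf st) ->].
- move=> r e c y s t A st _ /=; rewrite !dom_cat !all_cat /= !andbT.
  by case/and3P => -> /and3P[-> -> /(lstep_wf st) ->] ->.
- move=> e1 e2 s; rewrite bv_let bv_let => U /= /and3P[_ we1 /and3P[_ we2 ws]].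
  rewrite all_cat we1 we2 ws !andbT dom_cat.
  apply: subseq_uniq U; apply: cat_subseq => //.
  exact: subseq_trans (prefix_subseq _ _) (suffix_subseq _ _).
- move=> c x e1 s e2 A; rewrite bv_let => U /=; rewrite !all_cat /= !all_cat.
  case/and3P => _ /and3P[-> /and3P[_ -> ->] ->] ->; rewrite !andbT.
  move: U; rewrite /bvE map_cat flatten_cat /= !dom_cat [dom (_ :: _)]/= [dom (_ :: _)]/= dom_cat.
  set D := dom (links c x); set U := uniq _ => HU.
  have : perm_eq (D ++ x :: dom e1 ++ dom e2) ((D ++ x :: dom e2) ++ dom e1).
    by rewrite -catA perm_cat2l /= perm_cons perm_catC.
  move/perm_uniq ->; apply: subseq_uniq HU; apply: cat_subseq => //.
  rewrite -!catA.
  by apply: subseq_trans (suffix_subseq _ _); exact: prefix_subseq.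
- move=> xs x y s e A _ /=; rewrite !all_cat /= !wf_fillA /=.
  by case/and3P => -> /and3P[-> -> ->] /andP[-> _].
- move=> c x B ys y z s e A _ _ /=; rewrite !dom_cat !all_cat /= !dom_cat !all_cat /= !wf_fillA /=.
  by case/and3P => -> /and3P[-> /andP[-> _] /and3P[-> -> ->]] ->.
Qed.

(** [red2] lists the bindings of a chain in a fixed order, while [crel] leaves the right-hand
    environment in any order. Reordering the outermost environment reconciles them, as the rules do
    not look at the order anywhere deeper. *)
Inductive tperm : expr -> expr -> Prop :=
| tperm_refl s : tperm s s
| tperm_let e e' s : perm_eq e e' -> tperm (Let e s) (Let e' s).

Lemma tperm_aeq a b : tperm a b -> aeq a b.
Proof. by case=> *; [exact: aeq_refl|exact: aeq_perm]. Qed.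

Lemma tperm_sym a b : tperm a b -> tperm b a.
Proof. by case=> *; constructor; rewrite perm_sym. Qed.

Lemma tperm_trans a b c : tperm a b -> tperm b c -> tperm a c.
Proof.
case=> // e e' s P H; inversion H; subst; first by constructor.
by constructor; apply: perm_trans P _.
Qed.

Lemma tperm_bv a b : tperm a b -> perm_eq (bv a) (bv b).
Proof.
case=> // e e' s P; rewrite !bv_let perm_cat ?perm_dom // perm_cat2r.
by apply: perm_flatten; exact: perm_map.
Qed.

Lemma tperm_dvc a b : tperm a b -> dvc a = dvc b.
Proof.
move=> T; rewrite /dvc (perm_uniq (tperm_bv T)) (perm_all _ (tperm_bv T)); congr andb.
by apply: eq_all => x; rewrite (aeq_fv (tperm_aeq T)).
Qed.

(** * Simulation *)

Section Simulation.
Variable S : expr -> expr -> Prop.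

(* The next hole to be evaluated is reached along the spine (resp. in a
   reduction context); it is filled with the left member of its pair. *)
Definition spine_hole n a b := exists m A s t,
  [/\ n = m.+1, S s t, b = fillA A t & crel S m a (fillA A s)].

Definition ctx_hole n a b := exists m R s t,
  [/\ n = m.+1, S s t, tperm (fillR R t) b & crel S m a (fillR R s)].

Lemma spine_hole_top a b : S a b -> spine_hole 1 a b.
Proof. by move=> ab; exists 0, AHole, a, b; split=> //; exact: crel_refl. Qed.

Lemma spine_hole_app n m s s' t t' : spine_hole n s s' -> crel S m t t' ->
  spine_hole (n + m) (App s t) (App s' t').
Proof.
case=> k [A [u [v [-> uv -> C]]]] Ct; exists (k + m), (AApp A t'), u, v.
by split=> //; exact: crel_app.
Qed.

Lemma ctx_hole_top n a b : spine_hole n a b -> ctx_hole n a b.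
Proof.
case=> k [A [u [v [-> uv -> C]]]]; exists k, (RApp A), u, v; split=> //; exact: tperm_refl.
Qed.

Lemma ctx_hole_body n m e e1 e' s s' : crelE S n e e1 -> perm_eq e1 e' ->
  spine_hole m s s' -> ctx_hole (n + m) (Let e s) (Let e' s').
Proof.
move=> Ce P [k [A [u [v [-> uv -> C]]]]]; exists (n + k), (RLet e' A), u, v.
by split; rewrite ?addnS //; [exact: tperm_refl|exact: crel_let Ce P C].
Qed.

(** The case that gives rise to [RChain]: the links lead from the body to the binding with the hole,
    and [rest] collects all other bindings. *)
Lemma ctx_hole_chain n m e l1 rest c x A A0 u v s e' :
  S u v -> crelE S n e l1 ->
  perm_eq l1 (rest ++ links c x ++ [:: (x, fillA A u)]) ->
  perm_eq (rest ++ links c x ++ [:: (x, fillA A v)]) e' ->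
  crel S m s (fillA A0 (Var (first c x))) ->
  ctx_hole (n + m).+1 (Let e s) (Let e' (fillA A0 (Var (first c x)))).
Proof.
move=> uv Ce P P' C; exists (n + m), (RChain rest c x A A0), u, v; split=> //.
  exact: tperm_let.
exact: crel_let Ce P C.
Qed.

(** Every constructor that a rule inspects lies on the spine. If one of them belongs to a hole, that
    hole is the one evaluated next; otherwise the same redex is present on both sides. *)
Lemma lstep_sim r a a' : lstep r a a' -> forall n b, crel S n a b ->
  spine_hole n a b \/ exists b' m, lstep r b b' /\ crel S m a' b'.
Proof.
elim=> {r a a'}.
- move=> x s t n b /crel_appl[[-> /spine_hole_top]|]; first by left.
  case=> n1 [n2 [s1 [t1 [-> -> /crel_laml C Ct]]]].
  case: C => [[-> /spine_hole_top H]|[s2 -> Cs]]; first by left; exact: spine_hole_app.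
  right; exists (Let [:: (x, t1)] s2), ((n2 + 0) + n1); split; first exact: lstep_beta.
  by apply: crel_let (perm_refl _) Cs; apply: crelE_cons Ct _; exact: crelE_nil.
- move=> s t n b /crel_probl[[-> /spine_hole_top]|]; first by left.
  case=> n1 [n2 [s1 [t1 [-> -> Cs Ct]]]]; right; exists s1, n1; split=> //; exact: lstep_probl.
- move=> s t n b /crel_probl[[-> /spine_hole_top]|]; first by left.
  case=> n1 [n2 [s1 [t1 [-> -> Cs Ct]]]]; right; exists t1, n2; split=> //; exact: lstep_probr.
- move=> e s t n b /crel_appl[[-> /spine_hole_top]|]; first by left.
  case=> n1 [n2 [s1 [t1 [-> -> /crel_letl C Ct]]]].
  case: C => [[-> /spine_hole_top H]|]; first by left; exact: spine_hole_app.
  case=> k1 [k2 [e1 [e' [s' [-> -> Ce P Cs]]]]].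
  right; exists (Let e' (App s' t1)), (k1 + (k2 + n2)); split; first exact: lstep_lapp.
  by apply: crel_let Ce P _; exact: crel_app.
- move=> r s s' t _ IH n b /crel_appl[[-> /spine_hole_top]|]; first by left.
  case=> n1 [n2 [s1 [t1 [-> -> Cs Ct]]]].
  case: (IH _ _ Cs) => [H|[b' [m [st C]]]]; first by left; exact: spine_hole_app.
  right; exists (App b' t1), (m + n2); split; first exact: lstep_app.
  exact: crel_app.
Qed.

(** The first half transports the side condition [B <> AHole] of [CpE]. The second lets a copied
    abstraction take the place of the variable in both contexts. *)
Definition simA (A A' : actx) := (A' = AHole <-> A = AHole) /\
  forall k l l', crel S k l l' -> exists m, crel S m (fillA A l) (fillA A' l').

Inductive simC : seq (var * actx) -> seq (var * actx) -> Prop :=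
| simC_nil : simC [::] [::]
| simC_cons x A A' c c' : simA A A' -> simC c c' -> simC ((x, A) :: c) ((x, A') :: c').

Lemma var_sim A x n b : crel S n (fillA A (Var x)) b ->
  spine_hole n (fillA A (Var x)) b \/ exists2 A', b = fillA A' (Var x) & simA A A'.
Proof.
elim: A n b => [|A IH t] n b /=.
  case/crel_varl => [[-> /spine_hole_top]|[_ ->]]; first by left.
  right; exists AHole => //; split=> // k l l' C; by exists k.
case/crel_appl => [[-> /spine_hole_top]|]; first by left.
case=> n1 [n2 [s1 [t1 [-> -> Cs Ct]]]].
case: (IH _ _ Cs) => [H|[A' -> [HA sA]]]; first by left; exact: spine_hole_app.
right; exists (AApp A' t1) => //; split=> // k l l' /sA[m C].
by exists (m + n2); exact: crel_app.
Qed.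

Lemma simC_first c c' y : simC c c' -> first c' y = first c y.
Proof. by case. Qed.

Lemma simC_consl x A c c' : simC ((x, A) :: c) c' ->
  exists A' c1', [/\ c' = (x, A') :: c1', simA A A' & simC c c1'].
Proof. by move=> C; inversion C; subst; exists A', c'0. Qed.

Lemma simC_catl c1 c2 c' : simC (c1 ++ c2) c' ->
  exists c1' c2', [/\ c' = c1' ++ c2', simC c1 c1' & simC c2 c2'].
Proof.
elim: c1 c' => [|[x A] c1 IH] c' /= C; first by exists [::], c'; split=> //; exact: simC_nil.
have [A' [c3 [-> sA /IH[c1' [c2' [-> C1 C2]]]]]] := simC_consl C.
by exists ((x, A') :: c1'), c2'; split=> //; constructor.
Qed.

Lemma simC_vchain xs c' : simC (vchain xs) c' -> c' = vchain xs.
Proof.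
elim: xs c' => [|x xs IH] c' C; first by inversion C.
by have [A' [c1 [-> [[_ ->] // _] /IH ->]]] := simC_consl C.
Qed.

(** The recursion stops at the first link whose spine meets a hole. The links before it still form a
    chain on the right that begins at the same variable, so a body that demands this variable leads
    to that hole. *)
Lemma links_sim c y n l : crelE S n (links c y) l ->
  (exists2 c', l = links c' y & simC c c') \/
  (exists c1 x A u v l2 m, [/\ n = m.+1, S u v, l = links c1 x ++ (x, fillA A v) :: l2,
     first c1 x = first c y & crelE S m (links c y) (links c1 x ++ (x, fillA A u) :: l2)]).
Proof.
elim: c n l => [|[x A] c IH] n l /=.
  by move=> E; inversion E; left; exists [::] => //; exact: simC_nil.
case/crelE_consl => n1 [n2 [t' [l1 [-> -> Ct Cl]]]].
case: (var_sim Ct) => [[m [B [u [v [-> uv -> C]]]]]|[A' Et sA]].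
  right; exists [::], x, B, u, v, l1, (m + n2); split=> //.
  exact: crelE_cons C Cl.
subst t'; case: (IH _ _ Cl) => [[c' -> sC]|[c1 [x1 [B [u [v [l2 [m [-> uv -> F C]]]]]]]]].
  left; exists ((x, A') :: c'); last by constructor.
  by rewrite /= (simC_first _ sC).
right; exists ((x, A') :: c1), x1, B, u, v, l2, (n1 + m); split=> //=; rewrite ?addnS // F //.
exact: crelE_cons.
Qed.

Lemma ctx_hole_links n1 n2 n3 n4 pre pre' c y l post post' s s' A' e' :
  crelE S n1 pre pre' -> crelE S n2 (links c y) l -> crelE S n3 post post' ->
  crel S n4 s s' -> s' = fillA A' (Var (first c y)) ->
  perm_eq (pre' ++ l ++ post') e' ->
  ctx_hole (n1 + (n2 + n3) + n4) (Let (pre ++ links c y ++ post) s) (Let e' s') \/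
  exists2 c', l = links c' y & simC c c'.
Proof.
move=> C1 C2 C3 C4 Es P; case: (links_sim C2); first by right.
case=> c1 [x1 [B [u [v [l2 [m [-> uv El F Cl]]]]]]]; left; subst s' l.
have -> : n1 + (m.+1 + n3) + n4 = (n1 + (m + n3) + n4).+1 by lia.
rewrite -F in C4 *.
have Q w : perm_eq (pre' ++ (links c1 x1 ++ (x1, fillA B w) :: l2) ++ post')
    ((pre' ++ l2 ++ post') ++ links c1 x1 ++ [:: (x1, fillA B w)]).
  rewrite -!catA perm_cat2l /= perm_sym catA perm_catC -catA perm_cat2l /=.
  by rewrite perm_cons.
apply: (@ctx_hole_chain _ _ _ _ (pre' ++ l2 ++ post') _ _ _ _ _ _ _ _ uv
  (crelE_cat C1 (crelE_cat Cl C3)) (Q u) _ C4).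
by rewrite perm_sym; apply: perm_trans (Q v); rewrite perm_sym.
Qed.

Lemma ctx_hole_terminal n1 n2 n3 n4 n5 pre pre' c c' y T T' post post' s s' A' e' :
  crelE S n1 pre pre' -> crelE S n2 (links c y) (links c' y) -> spine_hole n3 T T' ->
  crelE S n4 post post' -> crel S n5 s s' -> s' = fillA A' (Var (first c' y)) ->
  perm_eq (pre' ++ links c' y ++ (y, T') :: post') e' ->
  ctx_hole (n1 + (n2 + (n3 + n4)) + n5) (Let (pre ++ links c y ++ (y, T) :: post) s) (Let e' s').
Proof.
move=> C1 C2 [k [B [u [v [-> uv -> C3]]]]] C4 C5 Es P; subst s'.
have -> : n1 + (n2 + (k.+1 + n4)) + n5 = (n1 + (n2 + (k + n4)) + n5).+1 by lia.
have Q w : perm_eq (pre' ++ links c' y ++ (y, fillA B w) :: post')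
    ((pre' ++ post') ++ links c' y ++ [:: (y, fillA B w)]).
  rewrite -!catA perm_cat2l perm_sym perm_catC -catA perm_cat2l.
  by rewrite perm_cons.
apply: (@ctx_hole_chain _ _ _ _ (pre' ++ post') _ _ _ _ _ _ _ _ uv
  (crelE_cat C1 (crelE_cat C2 (crelE_cons y C3 C4))) (Q u) _ C5).
by rewrite perm_sym; apply: perm_trans (Q v); rewrite perm_sym.
Qed.

(** Four constructors of [red2] share the shape of a chain ending in a binding [y = T]. Either a
    hole on the spine of the body or of a link comes first, or the chain is mirrored on the right
    and only [T] remains to be examined. The last implication is for a hole on the spine of [T]. *)
Lemma chain_sim n pre c y T post A b :
  crel S n (Let (pre ++ links c y ++ (y, T) :: post) (fillA A (Var (first c y)))) b ->
  ctx_hole n (Let (pre ++ links c y ++ (y, T) :: post) (fillA A (Var (first c y)))) b \/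
  exists n1 n2 n3 n4 n5 pre' c' T' post' A' e',
  [/\ n = n1 + (n2 + (n3 + n4)) + n5,
    b = Let e' (fillA A' (Var (first c' y))) /\
      crel S n5 (fillA A (Var (first c y))) (fillA A' (Var (first c' y))),
    perm_eq (pre' ++ links c' y ++ (y, T') :: post') e',
    simA A A' /\ simC c c' &
    [/\ crelE S n1 pre pre', crelE S n2 (links c y) (links c' y), crel S n3 T T',
        crelE S n4 post post' &
        spine_hole n3 T T' -> ctx_hole n (Let (pre ++ links c y ++ (y, T) :: post)
          (fillA A (Var (first c y)))) b]].
Proof.
case/crel_letl => [[-> H]|]; first by left; apply: ctx_hole_top; exact: spine_hole_top.
case=> m [n5 [e1 [e' [s' [-> -> Ce P Cs]]]]].
have [|[A' Es sA]] := var_sim Cs; first by left; exact: ctx_hole_body Ce P _.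
have [n1 [m2 [pre' [r1 [Em Er C1]]]]] := crelE_catl Ce; subst m e1.
case/crelE_catl => n2 [m3 [l [r2 [Em Er C2 Cr]]]]; subst m2 r1.
have [n3 [n4 [T' [post' [Em Er C3 C4]]]]] := crelE_consl Cr; subst m3 r2.
have [|[c' El sC]] := ctx_hole_links C1 C2 Cr Cs Es P; first by left.
subst l s'; right; exists n1, n2, n3, n4, n5, pre', c', T', post', A', e'.
rewrite (simC_first _ sC); split=> //; split=> // H.
by apply: ctx_hole_terminal C1 C2 H C4 Cs _ P; rewrite (simC_first _ sC).
Qed.

Lemma red2_sim r a t n b : red2 r a t -> crel S n a b ->
  ctx_hole n a b \/ exists b1 t' m, [/\ tperm b1 b, red2 r b1 t' & crel S m t t'].
Proof.
move=> st; case: st n b => {r a t}.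
- move=> r s t st n b C; case: (lstep_sim st C) => [/ctx_hole_top|[b' [m [? ?]]]]; first by left.
  right; exists b, b', m; split=> //; [exact: tperm_refl|exact: red2_top].
- move=> r e s t st n b.
  case/crel_letl => [[-> H]|]; first by left; apply: ctx_hole_top; exact: spine_hole_top.
  case=> m [k [e1 [e' [s' [-> -> Ce P Cs]]]]].
  case: (lstep_sim st Cs) => [H|[b' [j [? ?]]]]; first by left; exact: ctx_hole_body Ce P H.
  right; exists (Let e' s'), (Let e' b'), (m + j); split; first exact: tperm_refl.
    exact: red2_body.
  exact: crel_let Ce P _.
- move=> r e c y s t A st n b /chain_sim[|]; first by left.
  case=> n1 [n2 [n3 [n4 [n5 [e' [c' [s' [post' [A' [e'' [-> [-> C5] P [sA sC] [C1 C2 C3 C4 H]]]]]]]]]]]].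
  case: (lstep_sim st C3) => [/H|[t' [j [st' Ct]]]]; first by left.
  right; have Ep : post' = [::] by inversion C4.
  subst post'; exists (Let (e' ++ links c' y ++ [:: (y, s')]) (fillA A' (Var (first c' y)))).
  exists (Let (e' ++ links c' y ++ [:: (y, t')]) (fillA A' (Var (first c' y)))).
  exists (n1 + (n2 + (j + n4)) + n5); split; [exact: tperm_let|exact: red2_bind|].
  apply: crel_let _ (perm_refl _) C5.
  exact: crelE_cat C1 (crelE_cat C2 (crelE_cons y Ct C4)).
- move=> e1 e2 s n b.
  case/crel_letl => [[-> H]|]; first by left; apply: ctx_hole_top; exact: spine_hole_top.
  case=> m [k [e3 [e' [s' [-> -> Ce P Cs]]]]].
  case/crel_letl: Cs => [[-> H]|]; first by left; apply: ctx_hole_body Ce P _; exact: spine_hole_top.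
  case=> m' [k' [e4 [e'' [s'' [-> -> Ce' P' Cs]]]]].
  right; exists (Let e' (Let e'' s'')), (Let (e' ++ e'') s''), (m + m' + k').
  split; [exact: tperm_refl|exact: red2_llet_in|].
  by apply: (crel_let (crelE_cat Ce Ce') _ Cs); exact: perm_cat.
- move=> c x e1 s e2 A n b /(@chain_sim _ [::])[|]; first by left.
  case=> n1 [n2 [n3 [n4 [n5 [e' [c' [s' [post' [A' [e'' [-> [-> C5] P [sA sC] [C1 C2 C3 C4 H]]]]]]]]]]]].
  have Ep : e' = [::] by inversion C1.
  subst e'; case/crel_letl: C3 => [[? /spine_hole_top]|]; first by subst n3; left; exact: H.
  case=> m [k [e3 [e4 [s2 [Em Es' Ce Pe Cs]]]]]; subst n3 s'.
  right; exists (Let (links c' x ++ (x, Let e4 s2) :: post') (fillA A' (Var (first c' x)))).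
  exists (Let (links c' x ++ (x, s2) :: e4 ++ post') (fillA A' (Var (first c' x)))).
  exists (n2 + (k + (m + n4)) + n5); split; [exact: tperm_let|exact: red2_llet_e|].
  apply: crel_let (crelE_cat C2 (crelE_cons x Cs (crelE_cat Ce C4))) _ C5.
  by rewrite perm_cat2l perm_cons perm_cat2r.
- move=> xs x y s e A n b /(@chain_sim _ [::])[|]; first by left.
  case=> n1 [n2 [n3 [n4 [n5 [e' [c' [s' [post' [A' [e'' [-> [-> C5] P [sA sC] [C1 C2 C3 C4 H]]]]]]]]]]]].
  have Ep : e' = [::] by inversion C1.
  subst e'; case/crel_laml: C3 (C3) => [[? /spine_hole_top]|]; first by subst n3; left; exact: H.
  case=> s2 Es' Cs C3; subst s'; rewrite (simC_vchain sC) in C2 P *.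
  have [j Cj] := proj2 sA _ _ _ C3.
  right; exists (Let (links (vchain xs) x ++ (x, Lam y s2) :: post') (fillA A' (Var (first (vchain xs) x)))).
  exists (Let (links (vchain xs) x ++ (x, Lam y s2) :: post') (fillA A' (Lam y s2))).
  exists (n2 + (n3 + n4) + j); split; [exact: tperm_let|exact: red2_cp_in|].
  exact: crel_let (crelE_cat C2 (crelE_cons x C3 C4)) (perm_refl _) Cj.
- move=> c x B ys y z s e A BN n b.
  (* For [CpE], the links before [x], the link [x] itself and the variable chain after it are read
     as one chain, to which [chain_sim] applies. *)
  have E T : links c x ++ (x, fillA B (Var (first (vchain ys) y))) :: links (vchain ys) y ++ T
      = [::] ++ links (c ++ (x, B) :: vchain ys) y ++ T by rewrite links_cat -catA.
  have E1 : first c x = first (c ++ (x, B) :: vchain ys) y by rewrite first_cat.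
  rewrite E E1 => /chain_sim[|]; first by left.
  case=> n1 [n2 [n3 [n4 [n5 [e' [c' [s' [post' [A' [e'' [-> [-> C5] P [sA sC] [C1 C2 C3 C4 H]]]]]]]]]]]].
  have Ep : e' = [::] by inversion C1.
  subst e'; case/crel_laml: C3 (C3) => [[? /spine_hole_top]|]; first by subst n3; left; exact: H.
  case=> s2 Es' Cs C3; subst s'.
  have [c1 [c2 [Ec sC1 sC2]]] := simC_catl sC; subst c'.
  have [B' [c3 [Ec sB sV]]] := simC_consl sC2; subst c2.
  rewrite (simC_vchain sV) {sC sC2 sV H} in P C2 C5 *.
  rewrite !links_cat !first_cat /= in P C2 C5 *.
  have [k1 [k2 [l1 [l2 [_ El Cl1 Cl2]]]]] := crelE_catl C2.
  (* Two splittings of the same list agree once their first parts have equal length, and related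
     environments or chains do. *)
  have [El1 El2] : l1 = links c1 x /\ l2 = (x, fillA B' (Var (first (vchain ys) y))) :: links (vchain ys) y.
    have : size (links c1 x) == size l1.
      by rewrite -[size l1](size_map fst) -/(dom l1) -(crelE_dom Cl1) dom_links size_map;
        clear -sC1; elim: sC1 => //= *; rewrite eqSS.
    by move: El => /eqP + /eqP sz; rewrite eqseq_cat // => /andP[/eqP <- /eqP <-].
  subst l1 l2; have [k3 [k4 [T' [l3 [_ [<- <-] _ Cl3]]]]] := crelE_consl Cl2.
  have [j Cj] := proj2 sB _ _ _ C3.
  right; exists (Let (links c1 x ++ (x, fillA B' (Var (first (vchain ys) y))) ::
            links (vchain ys) y ++ (y, Lam z s2) :: post')
           (fillA A' (Var (first c1 x)))).
  exists (Let (links c1 x ++ (x, fillA B' (Lam z s2)) ::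
            links (vchain ys) y ++ (y, Lam z s2) :: post')
           (fillA A' (Var (first c1 x)))).
  exists (k1 + (j + (k4 + (n3 + n4))) + n5); split.
  + by apply: tperm_let; move: P; rewrite -catA.
  + by apply: red2_cp_e => AH; apply: BN; apply/(proj1 sB).
  + apply: crel_let _ (perm_refl _) C5.
    exact: crelE_cat Cl1 (crelE_cons x Cj (crelE_cat Cl3 (crelE_cons y C3 C4))).
Qed.

End Simulation.

(** * Determinism *)

Fixpoint hd (s : expr) : expr := if s is App s _ then hd s else s.

Lemma hd_fillA A s : hd (fillA A s) = hd s.
Proof. by elim: A. Qed.

(** Tells where a chain stops: a link has a variable at its head, while the term a rule acts on
    never does. *)
Definition nonvar (s : expr) := forall x, hd s <> Var x.

Lemma lstep_nonvar r s t : lstep r s t -> nonvar s.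
Proof. by elim. Qed.

Lemma fillA_var_inj A A' x x' : fillA A (Var x) = fillA A' (Var x') -> A = A' /\ x = x'.
Proof.
elim: A A' => [|A IH u] [|A' u'] //=; first by case.
by case=> /IH[-> ->] ->.
Qed.

Definition choice_pair (r r' : rule) := is_prob r /\ is_prob r' /\ r <> r'.

Lemma lstep_det r s t r' t' : lstep r s t -> lstep r' s t' ->
  r = r' /\ t = t' \/ choice_pair r r'.
Proof.
move=> st; elim: st r' t' => {r s t}.
- by move=> x s t r' t' H; inversion H; subst; [left|inversion H4].
- by move=> s t r' t' H; inversion H; subst; [left|right].
- by move=> s t r' t' H; inversion H; subst; [right|left].
- by move=> e s t r' t' H; inversion H; subst; [left|inversion H4].
- move=> r s s' t st IH r' t' H; inversion H; subst; try by inversion st.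
  by case: (IH _ _ H4) => [[-> ->]|]; [left|right].
Qed.

Lemma env_functional (e : env void) x t t' : uniq (dom e) -> (x, t) \in e -> (x, t') \in e -> t = t'.
Proof.
elim: e => //= -[y u] e IH /andP[ye ue]; rewrite !inE.
have N w : (y, w) \in e -> False.
  by move=> yw; move/negP: ye; apply; apply/domP; exists w.
move=> /predU1P[[Ex Et]|xt] /predU1P[[Ex' Et']|xt'].
- by rewrite Et Et'.
- by subst y; have := N _ xt'.
- by subst y; have := N _ xt.
- exact: IH.
Qed.

(** Each variable is bound once, so a link determines the next variable. Neither chain can stop
    before the other, because the head of a link is a variable and the heads of [T] and [T'] are
    not. *)
Lemma chain_det (e : env void) c y T c' y' T' : uniq (dom e) ->
  {subset links c y <= e} -> {subset links c' y' <= e} -> first c y = first c' y' ->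
  (y, T) \in e -> (y', T') \in e -> nonvar T -> nonvar T' -> [/\ c = c', y = y' & T = T'].
Proof.
move=> ue + + + yT y'T' NT NT'; elim: c c' => [|[x A] c IH] [|[x' A'] c'] /= S S' F.
- by subst y'; split=> //; apply: env_functional ue yT y'T'.
- subst y; have H := S' _ (mem_head _ _).
  by have := NT (first c' y'); rewrite (env_functional ue yT H) hd_fillA.
- subst y'; have H := S _ (mem_head _ _).
  by have := NT' (first c y); rewrite (env_functional ue y'T' H) hd_fillA.
- subst x'; have H := S _ (mem_head _ _); have H' := S' _ (mem_head _ _).
  have [<- E] := fillA_var_inj (env_functional ue H H').
  have [b bl|b bl|-> -> ->] // := IH c' _ _ E; [apply: S|apply: S']; by rewrite inE bl orbT.
Qed.

(* The subterm T that decides the next step of let e in b: either the body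
   itself, or the binding of y reached from the body through the chain c. *)
Definition focus (e : env void) (b : expr) (o : option (seq (var * actx) * var)) (T : expr) :=
  nonvar T /\ match o with
  | None => T = b
  | Some (c, y) => [/\ exists A, b = fillA A (Var (first c y)), {subset links c y <= e}
                     & (y, T) \in e]
  end.

Lemma focus_det e b o T o' T' : uniq (dom e) -> focus e b o T -> focus e b o' T' ->
  o = o' /\ T = T'.
Proof.
move=> ue [NT H] [NT' H']; case: o o' H H' => [[c y]|] [[c' y']|] H H'.
- case: H H' => -[A ->] S yT [[A' /fillA_var_inj[_ F]] S' yT'].
  by have [-> -> ->] := chain_det ue S S' F yT yT' NT NT'.
- by case: H NT' => -[A Eb] _ _; subst => /(_ (first c y)); rewrite hd_fillA.
- by case: H' NT => -[A Eb] _ _; subst => /(_ (first c' y')); rewrite hd_fillA.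
- by subst.
Qed.

(* The term obtained by putting T' at the focus and adding the bindings e1. *)
Definition result (e : env void) (b : expr) (o : option (seq (var * actx) * var))
    (e1 : env void) (T' t : expr) :=
  match o with
  | None => exists2 e', perm_eq e' (e ++ e1) & t = Let e' T'
  | Some (_, y) => exists e0 e' T, [/\ perm_eq e ((y, T) :: e0),
                     perm_eq e' ((y, T') :: e1 ++ e0) & t = Let e' b]
  end.

Lemma env_perm_det (e : env void) x T T' e0 e0' : uniq (dom e) ->
  perm_eq e ((x, T) :: e0) -> perm_eq e ((x, T') :: e0') -> perm_eq e0 e0'.
Proof.
move=> ue P P'; have E : T = T'.
  by apply: env_functional ue _ _; [rewrite (perm_mem P)|rewrite (perm_mem P')]; exact: mem_head.
by rewrite -(perm_cons (x, T)) {2}E; apply: perm_trans P'; rewrite perm_sym.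
Qed.

Lemma result_det e b o e1 T' t t' : uniq (dom e) ->
  result e b o e1 T' t -> result e b o e1 T' t' -> aeq t t'.
Proof.
move=> ue; case: o => [[c y]|] /=.
  case=> e0 [e' [T [P Q ->]]] [e0' [e'' [T'' [P' Q' ->]]]]; apply: aeq_perm.
  apply: (perm_trans Q); rewrite perm_sym; apply: (perm_trans Q').
  by rewrite perm_cons perm_cat2l; exact: env_perm_det ue P' P.
case=> e' P -> [e'' P' ->]; apply: aeq_perm; apply: perm_trans P _.
by rewrite perm_sym.
Qed.

(** The rules sorted by the term at the focus, with environments used up to order. As the focus is
    unique, determinism becomes a comparison of two actions on the same [T]. *)
Inductive act (e : env void) (b : expr) (o : option (seq (var * actx) * var)) :
    rule -> expr -> expr -> Prop :=
| act_step r T T' t : lstep r T T' -> result e b o [::] T' t -> act e b o r T t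
| act_let e1 s t : result e b o e1 s t ->
    act e b o (if o is None then LletIn else LletE) (Let e1 s) t
| act_cp_in xs x y s A e' : o = Some (vchain xs, x) ->
    b = fillA A (Var (first (vchain xs) x)) -> perm_eq e e' ->
    act e b o CpIn (Lam y s) (Let e' (fillA A (Lam y s)))
| act_cp_e c x B ys y z s T e0 e' : o = Some (c ++ (x, B) :: vchain ys, y) -> B <> AHole ->
    perm_eq e ((x, T) :: e0) -> perm_eq e' ((x, fillA B (Lam z s)) :: e0) ->
    act e b o CpE (Lam z s) (Let e' b).

(** [CpE] copies into the last link of the chain with a nonempty application context. All links
    after it are bare variables, so its position can be read off the whole chain. *)
Lemma last_nonempty_det c x B ys c' x' B' ys' : B <> AHole -> B' <> AHole ->
  c ++ (x, B) :: vchain ys = c' ++ (x', B') :: vchain ys' -> x = x' /\ B = B'.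
Proof.
have N zs d w D : vchain zs = d ++ (w, D) :: vchain ys' -> D = AHole.
  by elim: zs d => [|z zs IH] [|b d] //= [] // _ /IH.
have N' zs d w D : vchain zs = d ++ (w, D) :: vchain ys -> D = AHole.
  by elim: zs d => [|z zs IH] [|b d] //= [] // _ /IH.
move=> BN BN'; elim: c c' => [|b c IH] [|b' c'] //= [].
- by [].
- by move=> _ /N.
- by move=> _ /esym/N'.
- by move=> _ /IH.
Qed.

Lemma act_det e b o r T t r' t' : uniq (dom e) -> act e b o r T t -> act e b o r' T t' ->
  r = r' /\ aeq t t' \/ choice_pair r r'.
Proof.
move=> ue; case=> {r T t}.
- move=> r T T' t st R H; inversion H as [r1 T1 T1' t1 st1 R1|e1 s t1 R1 Er ET|xs x y s A e' Eo Eb P Er ET|c x B ys y z s T1 e0 e' Eo BN P Q Er ET];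
    subst; try by inversion st.
  case: (lstep_det st st1) => [[-> ET]|]; last by right.
  by left; split=> //; subst; exact: result_det ue R R1.
- move=> e1 s t R H; inversion H as [r1 T1 T1' t1 st1 R1|e2 s2 t1 R1 Er ET|xs x y s2 A e' Eo Eb P Er ET|c x B ys y z s2 T1 e0 e' Eo BN P Q Er ET];
    subst; first by inversion st1.
  by left; split=> //; exact: result_det ue R R1.
- move=> xs x y s A e' Eo Eb P H; inversion H as [r1 T1 T1' t1 st1 R1|e2 s2 t1 R1 Er ET|xs2 x2 y2 s2 A2 e2 Eo2 Eb2 P2 Er ET|c x2 B ys y2 z s2 T1 e0 e2 Eo2 BN P2 Q Er ET];
    subst; first by inversion st1.
    case: Eo2 => Exs Ex; subst; rewrite Exs in Eb2; have [-> _] := fillA_var_inj Eb2.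
    left; split=> //; apply: aeq_perm; apply: perm_trans P2; by rewrite perm_sym.
  (* [CpIn] and [CpE] exclude each other: a chain of bare variables has no link with
     [B <> AHole]. *)
  case: Eo2 => E _; exfalso; apply: BN; clear -E.
  by elim: xs c E => [|w xs IH] [|b c] //= [] // _ /IH.
- move=> c x B ys y z s T e0 e' Eo BN P Q H; inversion H as [r1 T1 T1' t1 st1 R1|e2 s2 t1 R1 Er ET|xs2 x2 y2 s2 A2 e2 Eo2 Eb2 P2 Er ET|c2 x2 B2 ys2 y2 z2 s2 T1 e2 e3 Eo2 BN2 P2 Q2 Er ET];
    subst; first by inversion st1.
    case: Eo2 => E _; exfalso; apply: BN; clear -E.
    by elim: xs2 c E => [|w xs IH] [|b c] //= [] // _ /IH.
  case: Eo2 => /(last_nonempty_det BN BN2)[Ex EB] _; subst.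
  left; split=> //; apply: aeq_perm; apply: (perm_trans Q); rewrite perm_sym; apply: (perm_trans Q2).
  by rewrite perm_cons; exact: env_perm_det ue P2 P.
Qed.

Lemma red2_act r e b t e2 : red2 r (Let e b) t -> perm_eq e e2 ->
  exists o T, focus e2 b o T /\ act e2 b o r T t.
Proof.
have sub (l l' : env void) : perm_eq (l ++ l') e2 -> {subset l <= e2}.
  by move=> P z zl; rewrite -(perm_mem P) mem_cat zl.
move=> H; inversion H as [r1 s1 t1 st|r1 e1 s1 t1 st|r1 e1 c y s1 t1 A st|e1 e3 s1
  |c x e1 s1 e3 A|xs x y s1 e1 A|c x B ys y z s1 e1 A BN]; subst => P.
- by inversion st.
- exists None, b; split; first by split=> //; exact: lstep_nonvar st.
  by apply: act_step st _; exists e => //; rewrite cats0.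
- exists (Some (c, y)), s1; split.
    split; first exact: lstep_nonvar st.
    split; first by exists A.
      by apply: (sub _ (e1 ++ [:: (y, s1)])); apply: perm_trans P; rewrite catA perm_sym perm_catCA catA.
    by rewrite -(perm_mem P) !mem_cat mem_head !orbT.
  apply: act_step st _; exists (e1 ++ links c y), (e1 ++ links c y ++ [:: (y, t1)]), s1.
  split=> //; last by rewrite catA perm_catC.
  by rewrite perm_sym; apply: perm_trans P; rewrite -cat1s perm_catC -catA.
- exists None, (Let e3 s1); split; first by split.
  by apply: act_let; exists (e ++ e3) => //; rewrite perm_cat2r.
- exists (Some (c, x)), (Let e1 s1); split.
    split; first by [].
    split; [by exists A|exact: sub P|].
    by rewrite -(perm_mem P) mem_cat mem_head orbT.
  apply: (@act_let _ _ (Some (c, x))).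
  exists (links c x ++ e3), (links c x ++ (x, s1) :: e1 ++ e3), (Let e1 s1).
  split=> //; last by rewrite -cat1s perm_catCA /= perm_cons perm_catCA.
  by rewrite perm_sym; apply: perm_trans P; rewrite -cat1s perm_catCA.
- exists (Some (vchain xs, x)), (Lam y s1); split.
    split; first by [].
    split; [by exists A|exact: sub P|].
    by rewrite -(perm_mem P) mem_cat mem_head orbT.
  by apply: (act_cp_in _ _ (erefl _) (erefl _)); rewrite perm_sym.
- exists (Some (c ++ (x, B) :: vchain ys, y)), (Lam z s1); split.
    split; first by [].
    split; first by exists A; rewrite first_cat.
      by rewrite links_cat; apply: (sub _ ((y, Lam z s1) :: e1)); rewrite -catA.
    by rewrite -(perm_mem P) !(mem_cat, inE) eqxx !orbT.
  apply: (@act_cp_e _ _ _ c x B ys y z s1 (fillA B (Var (first (vchain ys) y)))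
    (links c x ++ links (vchain ys) y ++ (y, Lam z s1) :: e1)) => //.
    by rewrite perm_sym; apply: perm_trans P; rewrite -cat1s perm_catCA.
  by rewrite -cat1s perm_catCA.
Qed.

Lemma red2_det r a t r' a' t' : red2 r a t -> red2 r' a' t' -> tperm a a' -> wf a ->
  r = r' /\ aeq t t' \/ choice_pair r r'.
Proof.
move=> st st' aa'; case: aa' st st' => [s|e e' s P] st st'.
  case: s st st' => [[]|x|x s|s u|s u|e s] st st' w; try by inversion st as [? ? ? st1| | | | | |]; inversion st1.
  - inversion st; subst; inversion st'; subst.
    by case: (lstep_det H H0) => [[-> ->]|]; [left; split=> //; exact: aeq_refl|right].
  - inversion st; subst; inversion st'; subst.
    by case: (lstep_det H H0) => [[-> ->]|]; [left; split=> //; exact: aeq_refl|right].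
  case/and3P: w => ue _ _.
  have [o [T [F A]]] := red2_act st (perm_refl _).
  have [o' [T' [F' A']]] := red2_act st' (perm_refl _).
  have [Eo ET] := focus_det ue F F'; subst.
  exact: act_det ue A A'.
move=> /and3P[ue _ _].
have [o [T [F A]]] := red2_act st (perm_refl _).
have [o' [T' [F' A']]] : exists o T, focus e s o T /\ act e s o r' T t'.
  by apply: red2_act st' _; rewrite perm_sym.
have [Eo ET] := focus_det ue F F'; subst.
exact: act_det ue A A'.
Qed.

(** * Standard reduction on equivalence classes *)

Local Open Scope quotient_scope.

Lemma pi_aeq (s t : expr) : \pi_aexpr s = \pi_aexpr t <-> aeq s t.
Proof.
split=> [/eqP|st]; first by rewrite eqmodE => /asboolP.
by apply/eqP; rewrite eqmodE; apply/asboolP.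
Qed.

Lemma dvc_fresh s X : wf s -> exists s', [/\ aeq s s', dvc s' & {in bv s', forall y : var, y \notin (X : seq var)}].
Proof.
move=> ws; have [s' [A U D]] := aeq_fresh (X ++ fv s) ws; exists s'; split=> //.
  rewrite /dvc U /=; apply/allP => y /D; rewrite mem_cat negb_or -(aeq_fv A).
  by case/andP.
by move=> y /D; rewrite mem_cat negb_or => /andP[].
Qed.

(** The simulation for [no_rel], whose hole outcome would require a pair in the empty relation. The
    aligning permutation fixes the free names of [a], hence those of [t], so it does not change the
    class of the result. *)
Lemma red2_aeq r a t a' : red2 r a t -> dvc a -> dvc a' ->
  {in bv a, forall x, x \notin bv a'} -> aeq a a' ->
  exists a1 t1, [/\ tperm a1 a', red2 r a1 t1 & aeq t t1].
Proof.
move=> st da da' D A; have [p [n [F C]]] := aeq_align da da' D A.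
case: (red2_sim (red2_ren (pv p) st) C) => [[m [R [u [v [_ []]]]]]|].
case=> a1 [t1 [m [T st1 C1]]]; exists a1, t1; split=> //.
apply: aeq_trans (crel_no_aeq C1); apply: aeq_sym; apply: aeq_ren_id => // x.
by move/(red2_fv st)/F.
Qed.

Lemma sr_red2 r u v : sr r u v <->
  exists s t, [/\ u = \pi_aexpr s, v = \pi_aexpr t, dvc s & red2 r s t].
Proof.
split=> -[s [t [-> -> ds st]]]; exists s, t; split=> //; first exact: red_red2.
exact: red2_red.
Qed.

(** The two steps may start from different representatives with binders in common. Both are moved to
    a third one, [c], fresh for either, where [red2_det] compares them. *)
Lemma sr_det r u v r' v' : sr r u v -> sr r' u v' -> r = r' /\ v = v' \/ choice_pair r r'.
Proof.
move=> /sr_red2[a [t [-> -> da st]]] /sr_red2[a' [t' [/pi_aeq aa' -> da' st']]].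
have [c [ac dc D]] := dvc_fresh (bv a ++ bv a') (dvc_wf da).
have D1 x : x \in bv a -> x \notin bv c.
  by move=> xa; apply/negP => /D; rewrite mem_cat xa.
have D2 x : x \in bv a' -> x \notin bv c.
  by move=> xa; apply/negP => /D; rewrite mem_cat xa orbT.
have [a1 [t1 [T1 st1 A1]]] := red2_aeq st da dc D1 ac.
have [a2 [t2 [T2 st2 A2]]] := red2_aeq st' da' dc D2 (aeq_trans (aeq_sym aa') ac).
have da1 : dvc a1 by rewrite (tperm_dvc T1).
case: (red2_det st1 st2 (tperm_trans T1 (tperm_sym T2)) (dvc_wf da1)); last by right.
case=> -> t12; left; split=> //; apply/pi_aeq.
exact: aeq_trans A1 (aeq_trans t12 (aeq_sym A2)).
Qed.

Lemma sr_prob r u v : sr r u v -> is_prob r ->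
  exists v1 v2, sr Probl u v1 /\ sr Probr u v2.
Proof.
case=> s [t [-> _ ds st]] pr.
have [R [s1 [t1 E]]] : exists R s1 t1, s = fillR R (Prob s1 t1).
  by case: st pr {ds} => // R s1 t1 _; exists R, s1, t1.
subst s; exists (\pi_aexpr (fillR R s1)), (\pi_aexpr (fillR R t1)).
by split; exists (fillR R (Prob s1 t1)); [exists (fillR R s1)|exists (fillR R t1)]; split=> //; constructor.
Qed.

Lemma whnf_pi a : whnf (\pi_aexpr a) ->
  (exists x s, a = Lam x s) \/ (exists e x s, a = Let e (Lam x s)).
Proof.
case=> [[x [s /pi_aeq/aeq_hrel]]|[e [x [s /pi_aeq/aeq_hrel]]]].
  by case: a => // y s' _; left; exists y, s'.
case: a => // e' a [p [e1 [_ _ _ /aeq_hrel]]].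
case: a => // y s' _; right; by exists e', y, s'.
Qed.

Lemma whnf_sr r u v : whnf u -> ~ sr r u v.
Proof.
move=> wu /sr_red2[a [t [Eu _ _ st]]]; subst u.
case: (whnf_pi wu) => [[x [s E]]|[e [x [s E]]]]; subst a.
  by inversion st as [? ? ? st1| | | | | |]; inversion st1.
have [o [T [[NT F] A]]] := red2_act st (perm_refl _).
case: o F A => [[c y] [[A E] _ _]|-> A].
  by have := congr1 hd E; rewrite hd_fillA.
by inversion A as [? ? ? ? st1| | |]; first inversion st1.
Qed.

(** * Reduction contexts under well-formedness, renaming and [aeq] *)

Lemma wf_fillR R s : wf (fillR R s) = wf_rctx R && wf s.
Proof.
have wl c y : all (fun b => wf b.2) (links c y) = all (fun b => wf_actx b.2) c.
  by elim: c => [|[x A] c IH] //=; rewrite IH wf_fillA andbT.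
case: R => [A|e A|e c y B A] /=; rewrite ?wf_fillA -?andbA //.
rewrite !dom_cat dom_links !all_cat /= wf_fillA wl !andbT -!andbA.
by congr [&& _, _, _, _ & _]; rewrite andbC.
Qed.

Definition renR f (R : rctx) : rctx :=
  match R with
  | RApp A => RApp (renA f A)
  | RLet e A => RLet (renE f e) (renA f A)
  | RChain e c y B A => RChain (renE f e) (renC f c) (f y) (renA f B) (renA f A)
  end.

Lemma ren_fillR f R s : ren f (fillR R s) = fillR (renR f R) (ren f s).
Proof.
case: R => [A|e A|e c y B A] /=; rewrite ?ren_fillA //.
by rewrite -/(renE f _) !renE_cat renE_links first_renC /= ren_fillA.
Qed.

Lemma wf_renR f R : injective f -> wf_rctx (renR f R) = wf_rctx R.
Proof.
move=> fI; have := wf_ren (fillR R (Var 0)) fI.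
by rewrite ren_fillR !wf_fillR !andbT.
Qed.

Lemma aeq_fillA A s t : aeq s t -> aeq (fillA A s) (fillA A t).
Proof. by move=> st; elim: A => //= A IH u; apply: aeq_app => //; exact: aeq_refl. Qed.

Lemma aeq_fillR R s t : aeq s t -> aeq (fillR R s) (fillR R t).
Proof.
move=> st; case: R => [A|e A|e c y B A] /=; first exact: aeq_fillA.
  by apply: aeq_let_in; exact: aeq_fillA.
apply: aeq_let (aeq_refl _); do 2!apply: eqE_cat (eqE_refl _) _.
by constructor; [exact: aeq_fillA|exact: eqE_nil].
Qed.

(** * Simulation on equivalence classes *)

Section ClassSimulation.
Variable S : expr -> expr -> Prop.
Hypothesis S_wf : forall s t, S s t -> wf s /\ wf t.
Hypothesis S_pt : forall p s t, S s t -> S (pt p s) (pt p t).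
Hypothesis S_aeq : forall s s' t t', S s t -> aeq s s' -> aeq t t' -> S s' t'.

(** Unlike in [ctx_hole], both sides are taken up to [aeq], because the step is examined on chosen
    representatives; [wf_rctx R] is recorded for the hypothesis on reduction contexts. *)
Definition class_hole n a b := exists m R s t a',
  [/\ n = m.+1, S s t, wf_rctx R, aeq (fillR R t) b & aeq a a' /\ crel S m a' (fillR R s)].

Lemma ctx_hole_class n a b : wf b -> ctx_hole S n a b -> class_hole n a b.
Proof.
move=> wb [m [R [s [t [-> st /tperm_aeq T C]]]]]; exists m, R, s, t, a; split=> //.
  by move: wb; rewrite -(aeq_wf T) wf_fillR => /andP[].
by split=> //; exact: aeq_refl.
Qed.

Lemma crel_tperm n a a' b : crel S n a b -> tperm a a' -> crel S n a' b.
Proof.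
move=> C T; case: T C => // e e' s P C.
case: (crel_letl C) => [[-> H]|].
  by apply: crel_hole; apply: S_aeq H _ (aeq_refl _); exact: aeq_perm.
case=> n1 [n2 [e1 [e2 [s' [-> -> Ce P' Cs]]]]].
have [e3 Ce3 P3] := crelE_perm Ce P.
by apply: crel_let Ce3 _ Cs; apply: perm_trans P'; rewrite perm_sym.
Qed.

Lemma crel_dvc n a b X : crel S n a b -> wf a -> exists a' b',
  [/\ crel S n a' b', aeq a a' /\ aeq b b', dvc a', dvc b' &
      {in bv a', forall y : var, y \notin (X : seq var)}].
Proof.
move=> C wa; have wb : wf b by rewrite -(crel_wf S_wf C).
have Sf s t : S s t -> forall Y : seq var, exists s' t', [/\ S s' t', aeq s s', aeq t t',
    uniq (bv s') && uniq (bv t') & {in bv s' ++ bv t', forall y, y \notin Y}].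
  move=> st Y; have [ws wt] := S_wf st.
  have [s' [As Us Ds]] := aeq_fresh Y ws; have [t' [At Ut Dt]] := aeq_fresh Y wt.
  exists s', t'; split=> //; first exact: S_aeq st As At.
    by rewrite Us.
  by move=> y; rewrite mem_cat => /orP[/Ds|/Dt].
have [a' [b' [C' A B /andP[Ua Ub] D]]] := crel_freshen S_pt Sf C wa wb (X ++ fv a ++ fv b).
exists a', b'; split=> //.
- rewrite /dvc Ua /=; apply/allP => y ya; have := D y; rewrite !mem_cat ya /= -(aeq_fv A).
  by rewrite !negb_or => /(_ isT)/and3P[].
- rewrite /dvc Ub /=; apply/allP => y ya; have := D y; rewrite !mem_cat ya orbT -(aeq_fv B).
  by rewrite !negb_or => /(_ isT)/and3P[].
- by move=> y ya; have := D y; rewrite !mem_cat ya !negb_or => /(_ isT)/andP[].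
Qed.

(** The representatives of the two sides are chosen together, so that they stay related and both
    satisfy [dvc]. The binders of the left one avoid those of [a0], the source of the given step,
    which can therefore be moved there. *)
Lemma sr_sim n a b r v : crel S n a b -> wf a -> sr r (\pi_aexpr a) v ->
  class_hole n a b \/ exists m a' b',
    [/\ v = \pi_aexpr a', wf a', crel S m a' b' & sr r (\pi_aexpr b) (\pi_aexpr b')].
Proof.
move=> C wa /sr_red2[a0 [t0 [/pi_aeq aa0 -> da0 st]]].
have [a1 [b1 [C1 [A B] da1 db1 D]]] := crel_dvc (bv a0) C wa.
have D0 : {in bv a0, forall x, x \notin bv a1}.
  by move=> x xa; apply/negP => /D; rewrite xa.
have [a2 [t2 [T2 st2 A2]]] := red2_aeq st da0 da1 D0 (aeq_trans (aeq_sym aa0) A).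
have C2 := crel_tperm C1 (tperm_sym T2).
have da2 : dvc a2 by rewrite (tperm_dvc T2).
case: (red2_sim st2 C2) => [/(ctx_hole_class (dvc_wf db1))|].
  case=> m [R [s [u [a' [-> su wR Rb [Aa Ca]]]]]]; left; exists m, R, s, u, a'; split=> //.
    exact: aeq_trans Rb (aeq_sym B).
  split=> //; apply: aeq_trans Aa; apply: aeq_trans A _.
  exact/aeq_sym/tperm_aeq.
case=> b2 [t3 [m [T3 st3 C3]]]; right; exists m, t2, t3; split=> //.
- exact/pi_aeq.
- by apply: red2_wf st2 _; case/andP: da2.
- apply/sr_red2; exists b2, t3; split=> //; last by rewrite (tperm_dvc T3).
  by apply/pi_aeq; apply: aeq_trans B _; exact/aeq_sym/tperm_aeq.
Qed.

Lemma whnf_sim n a b : crel S n a b -> wf a -> whnf (\pi_aexpr a) ->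
  class_hole n a b \/ whnf (\pi_aexpr b).
Proof.
move=> C wa; have wb : wf b by rewrite -(crel_wf S_wf C).
case/whnf_pi => [[x [s E]]|[e [x [s E]]]]; subst a.
  case: (crel_laml C) => [[-> H]|[s' -> _]].
    by left; apply: ctx_hole_class => //; apply: ctx_hole_top; exact: spine_hole_top.
  by right; left; exists x, s'.
case: (crel_letl C) => [[-> H]|].
  by left; apply: ctx_hole_class => //; apply: ctx_hole_top; exact: spine_hole_top.
case=> n1 [n2 [e1 [e' [s' [En Eb Ce P]]]]]; subst.
case/crel_laml => [[En2 H]|[s2 -> _]]; last by right; right; exists e', x, s2.
left; apply: ctx_hole_class => //; subst n2; apply: ctx_hole_body Ce P _.
exact: spine_hole_top.
Qed.

End ClassSimulation.

(** * Expected convergence *)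

Section Sums.
Variable F : realType.
Local Open Scope classical_set_scope.
Local Open Scope ring_scope.
Local Open Scope ereal_scope.

Notation evaluation := (seq (rule * aexpr)).

Definition weight (p : evaluation) : \bar F := (2 ^- prob_length p : F)%:E.

Lemma weight_ge0 p : 0 <= weight p.
Proof. by rewrite lee_fin invr_ge0 exprn_ge0. Qed.
#[local] Hint Resolve weight_ge0 : core.

Lemma esum_subset (T : choiceType) (A B : set T) (f : T -> \bar F) :
  A `<=` B -> \esum_(p in A) f p <= \esum_(p in B) f p.
Proof.
move=> AB; apply: ge_ereal_sup => _ [X [fX XA] <-]; apply: ereal_sup_ubound.
by exists X => //; split=> //; exact: subset_trans AB.
Qed.

Lemma esum_pZl (T : choiceType) (A : set T) (f : T -> \bar F) (c : F) :
  (0 < c)%R -> (forall x, 0 <= f x) ->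
  \esum_(p in A) (c%:E * f p) = c%:E * \esum_(p in A) f p.
Proof.
move=> c0 f0; rewrite /esum -ereal_sup_pZl //; congr ereal_sup.
apply/seteqP; split=> x /=.
  case=> X fX <-; exists (\sum_(x \in X) f x); first by exists X.
  by rewrite ge0_mule_fsumr.
case=> _ [X fX <-] <-; exists X => //.
by rewrite ge0_mule_fsumr.
Qed.

Lemma esumU (T : choiceType) (A B : set T) (f : T -> \bar F) :
  (forall x, 0 <= f x) -> A `&` B = set0 ->
  \esum_(p in A `|` B) f p = \esum_(p in A) f p + \esum_(p in B) f p.
Proof.
move=> f0 AB; rewrite (esumID A) //; congr (_ + _); congr esum.
  exact: setUK.
rewrite setIUl setICr set0U; apply/setIidPl => x Bx Ax.
by have : (A `&` B) x by []; rewrite AB.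
Qed.

Definition evals (u : aexpr) : set evaluation := [set p | is_evaluation u p].
Definition ev_prob u k := [set p : evaluation | is_evaluation u p /\ (prob_length p <= k)%N].
Definition ev_size u n := [set p : evaluation | is_evaluation u p /\ (size p <= n)%N].

Definition prefactor (r : rule) : F := (2 ^- is_prob r)%R.

Lemma prefactor_gt0 r : (0 < prefactor r)%R.
Proof. by rewrite invr_gt0 exprn_gt0. Qed.

Lemma esum_cons b (A : set evaluation) :
  \esum_(p in [set b :: p | p in A]) weight p = (prefactor b.1)%:E * \esum_(p in A) weight p.
Proof.
rewrite esum_image; last by move=> x y _ _ [].
rewrite -esum_pZl ?prefactor_gt0 //; apply: eq_esum => p _.
by rewrite /weight -EFinM /prefactor -invfM -exprD.
Qed.

Lemma ev_size_whnf u n : whnf u -> ev_size u n `<=` [set [::]].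
Proof.
by move=> wu [|[r v] p] [] //= -[sv _] _; have := whnf_sr wu sv.
Qed.

Lemma ev_size_step u n r v : sr r u v -> ~~ is_prob r ->
  ev_size u n.+1 `<=` [set (r, v) :: p | p in ev_size v n].
Proof.
move=> uv nr [|[r' v'] p] [/=]; first by move=> wu; have := whnf_sr wu uv.
move=> [uv' ep] sz; case: (sr_det uv uv') => [[Er Ev]|[]]; last by rewrite (negbTE nr).
by subst; exists p.
Qed.

Lemma ev_size_prob u n v1 v2 : sr Probl u v1 -> sr Probr u v2 ->
  ev_size u n.+1 `<=`
    [set (Probl, v1) :: p | p in ev_size v1 n] `|` [set (Probr, v2) :: p | p in ev_size v2 n].
Proof.
move=> uv1 uv2 [|[r' v'] p] [/=]; first by move=> wu; have := whnf_sr wu uv1.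
move=> [uv' ep] sz; case: (sr_det uv1 uv') => [[Er Ev]|]; first by subst; left; exists p.
case: (sr_det uv2 uv') => [[Er Ev]|]; first by subst; right; exists p.
(* [r'] would be a prob-rule different from both [Probl] and [Probr]. *)
move=> [_ [pr H]] [_ [_ H']]; exfalso.
by case: r' pr H H' {uv'}.
Qed.

Lemma ev_prob_cons u k r v : sr r u v ->
  [set (r, v) :: p | p in ev_prob v k] `<=` ev_prob u (k + is_prob r).
Proof.
move=> uv _ [p [ep pk] <-]; split=> //=.
by rewrite /prob_length /= addnC leq_add2r.
Qed.

Lemma ev_prob_le u k k' : (k <= k')%N -> ev_prob u k `<=` ev_prob u k'.
Proof. by move=> kk' p [? pk]; split=> //; exact: leq_trans kk'. Qed.

Lemma cons_disjoint v1 v2 (A B : set evaluation) :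
  [set (Probl, v1) :: p | p in A] `&` [set (Probr, v2) :: p | p in B] = set0.
Proof. by apply/seteqP; split=> // x [[p _ <-] [q _]]. Qed.

(** The passage to the limit: the sum is a supremum over finite sets of evaluations, and a finite
    set has a maximal length. *)
Lemma esum_finite_size u (y : \bar F) :
  (forall n, \esum_(p in ev_size u n) weight p <= y) -> \esum_(p in evals u) weight p <= y.
Proof.
move=> H; apply: ge_ereal_sup => _ [X [fX XA] <-].
have [n Xn] : exists n, X `<=` ev_size u n.
  case/finite_seqP: fX => s Es; subst X; exists (\max_(p <- s) size p) => p ps.
  by split; [exact: XA|exact: (@leq_bigmax_seq _ s xpredT (@size _) p)].
by apply: le_trans (H n); apply: ereal_sup_ubound; exists X.
Qed.

(** * Invariance of expected convergence under permutations *)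

Definition aren (p : prm) (u : aexpr) : aexpr := \pi_aexpr (pt p (repr u)).

Lemma aren_pi p a : aren p (\pi_aexpr a) = \pi_aexpr (pt p a).
Proof.
by apply/pi_aeq; apply: aeq_ren => //; apply/pi_aeq; rewrite reprK.
Qed.

Lemma arenK p : cancel (aren p) (aren (rev p)).
Proof.
move=> u; have [a ->] : exists a, u = \pi_aexpr a by exists (repr u); rewrite reprK.
by rewrite !aren_pi pt_revK.
Qed.

Lemma dvc_ren f s : injective f -> dvc s -> dvc (ren f s).
Proof.
move=> fI /andP[U /allP D]; rewrite /dvc bv_ren fv_ren // map_inj_uniq // U /=.
by apply/allP => _ /mapP[x /D xf ->]; rewrite mem_map.
Qed.

Lemma aren_sr p r u v : sr r u v -> sr r (aren p u) (aren p v).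
Proof.
case/sr_red2 => s [t [-> -> ds st]]; apply/sr_red2; exists (pt p s), (pt p t).
by rewrite !aren_pi; split=> //; [exact: dvc_ren|exact: red2_ren].
Qed.

Lemma aren_whnf p u : whnf u -> whnf (aren p u).
Proof.
case=> [[x [s ->]]|[e [x [s ->]]]]; rewrite aren_pi; [left|right].
  by exists (pv p x), (pt p s).
by exists (ptE p e), (pv p x), (pt p s).
Qed.

Lemma aren_evaluation p u q :
  is_evaluation u q -> is_evaluation (aren p u) [seq (b.1, aren p b.2) | b <- q].
Proof.
elim: q u => [|[r v] q IH] u /=; first exact: aren_whnf.
by case=> /(aren_sr p) ? /IH.
Qed.

(** Renaming every term of an evaluation is injective and keeps the rules, hence the weights. One
    inequality suffices, as [rev p] gives the other. *)
Lemma esum_aren_le p u k : \esum_(q in ev_prob u k) weight q <= \esum_(q in ev_prob (aren p u) k) weight q.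
Proof.
pose h (q : evaluation) := [seq (b.1, aren p b.2) | b <- q].
have hl q : prob_length (h q) = prob_length q by rewrite /prob_length count_map; exact: eq_count.
have hK : cancel h (fun q => [seq (b.1, aren (rev p) b.2) | b <- q]).
  move=> q; rewrite -map_comp -[RHS]map_id; apply: eq_map => -[r v] /=.
  by rewrite arenK.
have -> : \esum_(q in ev_prob u k) weight q = \esum_(q in ev_prob u k) weight (h q).
  by apply: eq_esum => q _; rewrite /weight hl.
rewrite -esum_image; last by move=> x y _ _; exact: (can_inj hK).
apply: esum_subset => _ [q [eq qk] <-]; split; last by rewrite hl.
exact: aren_evaluation.
Qed.

Lemma ExCvk_pt p a k : ExCvk F (pt p a) k = ExCvk F a k.
Proof.
apply/eqP; rewrite eq_le; apply/andP; split; last first.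
  by have := esum_aren_le p (\pi_aexpr a) k; rewrite aren_pi.
by have := esum_aren_le (rev p) (\pi_aexpr (pt p a)) k; rewrite aren_pi pt_revK.
Qed.

Lemma ExCvk_aeq a b k : aeq a b -> ExCvk F a k = ExCvk F b k.
Proof. by move=> /pi_aeq ab; rewrite /ExCvk ab. Qed.

(** The instance of [S] for the theorem: the hypothesis on one pair [s_i], [t_i], with the
    well-formedness that allows representatives to be freshened. *)
Definition ctx_le (s t : expr) := [/\ wf s, wf t &
  forall k R, wf_rctx R -> exists d, ExCvk F (fillR R s) k <= ExCvk F (fillR R t) (k + d)%N].

Lemma ctx_le_aeq s s' t t' : ctx_le s t -> aeq s s' -> aeq t t' -> ctx_le s' t'.
Proof.
move=> [ws wt H] A B; split; rewrite -?(aeq_wf A) -?(aeq_wf B) // => k R wR.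
have [d Hd] := H k R wR; exists d.
by rewrite -(ExCvk_aeq _ (aeq_fillR R A)) -(ExCvk_aeq _ (aeq_fillR R B)).
Qed.

(** Undoing the permutation on the whole term moves it from the expression to the context, over
    which the hypothesis quantifies. *)
Lemma ctx_le_pt p s t : ctx_le s t -> ctx_le (pt p s) (pt p t).
Proof.
move=> [ws wt H]; split; rewrite ?wf_ren // => k R wR.
have E u : ExCvk F (fillR R (pt p u)) =1 ExCvk F (fillR (renR (pv (rev p)) R) u).
  move=> j; rewrite -(ExCvk_pt (rev p)); congr ExCvk.
  by rewrite [LHS]/pt ren_fillR -/(pt (rev p) _) pt_revK.
have [|d Hd] := H k (renR (pv (rev p)) R); first by rewrite wf_renR.
by exists d; rewrite !E.
Qed.

(* The inner induction on the number of holes replaces a hole in evaluation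
   position by the left member of its pair, so that the hypothesis on
   reduction contexts applies to the right-hand side. *)
Lemma esum_size_le_prob N n a b : crel ctx_le n a b -> wf a ->
  exists d, \esum_(p in ev_size (\pi_aexpr a) N) weight p <= ExCvk F b d.
Proof.
have Swf s t : ctx_le s t -> wf s /\ wf t by case.
elim/ltn_ind: N n a b => N IHN; elim/ltn_ind => n IHn a b C wa.
have hole : class_hole ctx_le n a b ->
    exists d, \esum_(p in ev_size (\pi_aexpr a) N) weight p <= ExCvk F b d.
  case=> m [R [s [t [a' [En st wR Rb [Aa Ca]]]]]]; subst n.
  have wa' : wf a' by rewrite -(aeq_wf Aa).
  (* With one hole fewer and the same [N], the sum for [a'] is bounded by that of [R[s]] up to some
     [d]. The hypothesis is then used with this [d] as its [k]. *)
  have [d Hd] := IHn m (ltnSn m) a' _ Ca wa'.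
  have [_ _ /(_ d R wR)[d' Hd']] := st; exists (d + d')%N.
  move/pi_aeq: Aa => ->; apply: (le_trans Hd).
  by rewrite -(ExCvk_aeq _ Rb).
have sim r v (av : sr r (\pi_aexpr a) v) :=
  sr_sim Swf ctx_le_pt ctx_le_aeq C wa av.
(* If there is an evaluation of size at most [N], it shows whether the term is a WHNF or which rule
   comes first; otherwise the sum is empty. *)
have [[p [ep sp]]|NE] := pselect (exists p, ev_size (\pi_aexpr a) N p); last first.
  exists 0%N; rewrite (_ : ev_size _ _ = set0) ?esum_set0 ?esum_ge0 //.
  by apply/seteqP; split=> // p ep; apply: NE; exists p.
case: p ep sp => [wh _|[r v] p [av ep]].
  case: (whnf_sim Swf C wa wh) => [/hole //|wb]; exists 0%N.
  apply: le_trans (esum_subset _ (ev_size_whnf (n := N) wh)) _.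
  by apply: esum_subset => _ ->; split.
case: N IHN hole {IHn} => // N IHN hole _.
have [pr|pr] := boolP (is_prob r).
  have [v1 [v2 [av1 av2]]] := sr_prob av pr.
  case: (sim _ _ av1) => [/hole //|[m1 [a1 [b1 [E1 w1 C1 bv1]]]]].
  case: (sim _ _ av2) => [/hole //|[m2 [a2 [b2 [E2 w2 C2 bv2]]]]].
  have [d1 H1] := IHN N (ltnSn N) _ _ _ C1 w1.
  have [d2 H2] := IHN N (ltnSn N) _ _ _ C2 w2.
  rewrite -E1 in H1; rewrite -E2 in H2.
  (* The maximum serves both branches, the bound being monotone in [d], and the [1] pays for the
     prob-reduction just made. *)
  exists (maxn d1 d2 + 1)%N.
  apply: le_trans (esum_subset _ (ev_size_prob (n := N) av1 av2)) _.
  rewrite esumU ?cons_disjoint // !esum_cons.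
  apply: (@le_trans _ _ (\esum_(p in
      [set (Probl, \pi_aexpr b1) :: p | p in ev_prob (\pi_aexpr b1) (maxn d1 d2)] `|`
      [set (Probr, \pi_aexpr b2) :: p | p in ev_prob (\pi_aexpr b2) (maxn d1 d2)]) weight p)).
    rewrite [leRHS]esumU ?cons_disjoint // !esum_cons.
    apply: leeD; rewrite lee_pmul2l ?lte_fin ?prefactor_gt0 //.
      by apply: (le_trans H1); apply: esum_subset; apply: ev_prob_le; rewrite leq_maxl.
    by apply: (le_trans H2); apply: esum_subset; apply: ev_prob_le; rewrite leq_maxr.
  apply: esum_subset => x [/(ev_prob_cons bv1)|/(ev_prob_cons bv2)]; exact.
case: (sim _ _ av) => [/hole //|[m1 [a1 [b1 [E1 w1 C1 bv1]]]]].
have [d H] := IHN N (ltnSn N) _ _ _ C1 w1; rewrite -E1 in H; exists d.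
apply: le_trans (esum_subset _ (ev_size_step (n := N) av pr)) _.
apply: (@le_trans _ _ (\esum_(p in [set (r, \pi_aexpr b1) :: p | p in ev_prob (\pi_aexpr b1) d])
    weight p)).
  by rewrite !esum_cons lee_pmul2l ?lte_fin ?prefactor_gt0.
apply: esum_subset => x /(ev_prob_cons bv1); by rewrite (negbTE pr) addn0.
Qed.

(** Capture by the binders of [C] does no harm, since [crel] is likewise a relation on raw named
    syntax. *)
Lemma crel_plug n (C : term 'I_n) (s t : 'I_n -> expr) :
  (forall i, ctx_le (s i) (t i)) -> exists m, crel ctx_le m (plug C s) (plug C t).
Proof.
move=> st; elim/term_env_ind: C => /=.
- by move=> i; exists 1%N; exact: crel_hole.
- by move=> x; exists 0%N; exact: crel_var.
- by move=> x u [m H]; exists m; exact: crel_lam.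
- by move=> u v [m H] [k K]; exists (m + k)%N; exact: crel_app.
- by move=> u v [m H] [k K]; exists (m + k)%N; exact: crel_prob.
- move=> e u IHe [m H].
  have [k K] : exists k, crelE ctx_le k [seq (b.1, plug b.2 s) | b <- e] [seq (b.1, plug b.2 t) | b <- e].
    elim: e IHe => [_|[x v] e IH IHe]; first by exists 0%N; exact: crelE_nil.
    have [j J] := IHe x v (mem_head _ _).
    have [|k K] := IH; first by move=> y w yw; apply: (IHe y); rewrite inE yw orbT.
    by exists (j + k)%N; exact: crelE_cons.
  by exists (k + m)%N; exact: crel_let K (perm_refl _) H.
Qed.

End Sums.

Lemma wf_plug (H : Type) (C : term H) (s : H -> expr) :
  wf C -> (forall h, wf (s h)) -> wf (plug C s).
Proof.
move=> + ws; elim/term_env_ind: C => //=.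
- by move=> u v IHu IHv /andP[/IHu -> /IHv].
- by move=> u v IHu IHv /andP[/IHu -> /IHv].
- move=> e u IHe IHu /and3P[ue we /IHu ->]; rewrite andbT.
  have -> : dom [seq (b.1, plug b.2 s) | b <- e] = dom e by rewrite /dom -map_comp.
  rewrite ue /= all_map; apply/allP => -[x v] xv /=; apply: (IHe x) => //.
  by have /= := allP we _ xv.
Qed.

Theorem theorem3p4 (F : realType) (n : nat) (s t : 'I_n -> term void)
  (wf_s : forall i, wf (s i)) (wf_t : forall i, wf (t i))
  (hst : forall (i : 'I_n) (k : nat) (R : rctx), wf_rctx R ->
    exists d : nat,
      (ExCvk F (fillR R (s i)) k <= ExCvk F (fillR R (t i)) (k + d)%N)%E)
  (C : term 'I_n) (hC : is_multicontext C) :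
  (ExCv F (plug C s) <= ExCv F (plug C t))%E.
Proof.
have [m H] : exists m, crel (ctx_le F) m (plug C s) (plug C t).
  by apply: crel_plug => i; split=> // k R wR; exact: hst.
(* The offset [d] varies with [N], but each [ExCvk] is at most the full [ExCv]. *)
apply: esum_finite_size => N.
have [|d Hd] := @esum_size_le_prob F N _ _ _ H.
  by apply: wf_plug => //; case: hC.
by apply: le_trans Hd _; apply: esum_subset => p [].
Qed.
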